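(* Let $\Omega$ be a connected Stein manifold, let $\varphi:\Omega\to\Omega$ be holomorphic, and let $(n_l)_{l\in\mathbb{N}}$ be an increasing sequence of natural numbers. Then the operator $C_\varphi$ is hypercyclic with respect to $(n_l)_l$ if and only if $(n_l)_l$ has a subsequence with respect to which $C_\varphi$ is hereditarily hypercyclic.
   Context: A Stein manifold is a complex analytic manifold $\Omega$ of finite dimension $N$ such that: $\Omega$ has an exhaustion by compact sets $K_l$ with $K_l\subset\operatorname{int}K_{l+1}$ and $\bigcup_l K_l=\Omega$; the holomorphic hull $\widehat{K}_\Omega=\{z\in\Omega: |f(z)|\le\sup_K|f| \text{ for every } f\in\mathcal{O}(\Omega)\}$ of every compact set $K\subset\Omega$ is compact; holomorphic functions on $\Omega$ separate points; and for each $z\in\Omega$ some holomorphic map $F:\Omega\to\mathbb{C}^N$ has invertible derivative at $z$. $\mathcal{O}(\Omega)$ is the space of holomorphic functions $\Omega\to\mathbb{C}$ with the topology of uniform convergence on compact sets. $C_\varphi:\mathcal{O}(\Omega)\to\mathcal{O}(\Omega)$ is $C_\varphi(f)=f\circ\varphi$. For a self-map $T$, $T^{[n]}$ denotes its $n$-th iterate. ''Increasing'' means strictly increasing. A sequence $(T_l)_l$ of continuous self-maps of a topological space $X$ is universal if there is $x\in X$ with $\{T_l(x): l\in\mathbb{N}\}$ dense in $X$; it is hereditarily universal if each of its subsequences is universal. A continuous linear operator $T$ on a topological vector space is hypercyclic (resp. hereditarily hypercyclic) with respect to $(n_l)_l$ if $(T^{[n_l]})_l$ is universal (resp. hereditarily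 universal). *)

(* Defs.v *)
From HB Require Import structures.
From mathcomp Require Import all_boot all_order all_algebra.
From mathcomp Require Import complex.
From mathcomp Require Import all_classical all_reals all_analysis.

Set Implicit Arguments.
Unset Strict Implicit.
Unset Printing Implicit Defensive.

Import Order.TTheory GRing.Theory Num.Theory.
Import numFieldNormedType.Exports.

Local Open Scope classical_set_scope.
Local Open Scope ring_scope.
Local Open Scope complex_scope.

(* The normed space structure of the complex numbers over themselves. All
   occurrences of [differentiable] below are at normed modules over R[i], hence
   mean complex (Frechet) differentiability. *)
HB.instance Definition _ (R : realType) := NormedModule.copy R[i] R[i]^o.

HB.instance Definition _ (R : realType) (M : topologicalType) :=
  GRing.Lmodule.copy {family compact, M -> R[i]} (M -> R[i]).

Lemma set_val_continuous (X : topologicalType) (A : set X) :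
  continuous (set_val : A -> X).
Proof. exact: initial_continuous. Qed.

Lemma set_type_continuous (X Y : topologicalType) (A : set X) (g : Y -> A) :
  continuous (set_val \o g) -> continuous g.
Proof. exact: continuous_comp_initial. Qed.

Lemma precomp_continuous (Y M : topologicalType) (V : uniformType)
    (phi : M -> M) (g : Y -> {family compact, M -> V}) :
  continuous phi -> continuous g ->
  continuous ((fun y => (g y : M -> V) \o phi) : Y -> {family compact, M -> V}).
Proof.
move=> cphi cg y.
apply/fam_cvgP => K cK U /uniform_nbhs[E [entE EU]].
have cphiK : compact (phi @` K).
  by apply: continuous_compact => //; exact: continuous_subspaceT.
have /cg := @fam_nbhs _ _ compact _ E (g y) entE cphiK.
apply: (@filterS _ (nbhs y)) => z /= Ez; apply: EU => x Kx.
by apply: Ez; exists x.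
Qed.

(* [chart_map] and [chart_inv] are total functions, but only their values on
   [chart_dom] and on its image are meaningful. *)
Record chart (R : realType) (N : nat) (M : topologicalType) := Chart {
  chart_dom : set M ;
  chart_map :> M -> 'rV[R[i]]_N ;
  chart_inv : 'rV[R[i]]_N -> M ;
  chart_dom_open : open chart_dom ;
  chart_img_open : open (chart_map @` chart_dom) ;
  chart_mapK : forall x, chart_dom x -> chart_inv (chart_map x) = x ;
  chart_map_continuous : {within chart_dom, continuous chart_map} ;
  chart_inv_continuous :
    {within chart_map @` chart_dom, continuous chart_inv}
}.

(* The atlas need not be maximal. Countability at infinity is not required
   here; it is part of [stein]. *)
Record complexManifold (R : realType) (N : nat) := ComplexManifold {
  manifold_space :> topologicalType ;
  atlas : set (chart R N manifold_space) ;
  manifold_hausdorff : hausdorff_space manifold_space ;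
  atlas_cover : forall x, exists2 c, atlas c & chart_dom c x ;
  atlas_holomorphic : forall c c', atlas c -> atlas c' ->
    forall x, chart_dom c x -> chart_dom c' x ->
      differentiable (c' \o chart_inv c) (c x)
}.

Section Holomorphic.
Variables (R : realType) (N : nat) (M : complexManifold R N).

Definition holomorphic (V : normedModType R[i]) (f : M -> V) : Prop :=
  forall c, atlas c -> forall x, chart_dom c x ->
    differentiable (f \o chart_inv c) (c x).

Definition holomorphic_map (phi : M -> M) : Prop :=
  continuous phi /\
  forall c c', atlas c -> atlas c' ->
    forall x, chart_dom c x -> chart_dom c' (phi x) ->
      differentiable (c' \o phi \o chart_inv c) (c x).

(* In \bar R the supremum over K = set0 is -oo, so the hull of set0 is set0. *)
Definition holomorphic_hull (K : set M) : set M :=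
  [set z | forall f : M -> R[i], holomorphic f ->
    ((Normc.normc (f z))%:E <=
       ereal_sup [set (Normc.normc (f w))%:E | w in K])%E].

Definition stein : Prop :=
  [/\ exists K : nat -> set M,
        [/\ forall l, compact (K l),
            forall l, K l `<=` (K l.+1)^°
          & \bigcup_l K l = [set: M]],
      forall K : set M, compact K -> compact (holomorphic_hull K),
      forall x y : M, x <> y ->
        exists2 f : M -> R[i], holomorphic f & f x <> f y
    & forall z : M, exists2 F : M -> 'rV[R[i]]_N, holomorphic F &
        forall c, atlas c -> chart_dom c z ->
          'J (F \o chart_inv c) (c z) \in unitmx].

(* The set of holomorphic functions, with the topology of uniform convergence
   on compact sets inherited from {family compact, M -> R[i]}. *)
Definition holomorphic_set : set {family compact, M -> R[i]} :=
  [set f | holomorphic f].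

Definition holo_space : Type := set_type holomorphic_set.

HB.instance Definition _ := Uniform.on holo_space.

Lemma holomorphic_submod :
  submod_closed (fun f => f \in holomorphic_set : bool).
Proof.
split; first by apply/mem_set => c ac x cx; exact: differentiable_cst.
move=> a f g /set_mem hf /set_mem hg; apply/mem_set => c ac x cx.
by apply: differentiableD; [apply: differentiableZ; exact: hf|exact: hg].
Qed.

HB.instance Definition _ := SubChoice.on holo_space.
HB.instance Definition _ :=
  GRing.SubChoice_isSubLmodule.Build _ _ _ holo_space holomorphic_submod.

Lemma differentiable_near_eq (U V : normedModType R[i]) (f g : U -> V) x :
  (\near x, f x = g x) -> differentiable g x -> differentiable f x.
Proof.
move=> fg /diff_locallyP[cdg dg].
have fgx : f x = g x := nbhs_singleton fg.
have df : f \o shift x = cst (f x) + 'd g x +o_ 0 id.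
  have fg0 : \forall y \near 0, f (y + x) = g (y + x).
    by move: fg; rewrite (near_shift 0) /= subr0.
  apply/eqaddoP => e e0; move/eqaddoP : dg => /(_ e e0) dg.
  apply: filterS2 fg0 dg => y fgy.
  by rewrite !fctE /= fgy fgx.
apply/diff_locallyP; rewrite (diff_unique cdg df); split => //.
Qed.

Lemma holomorphic_comp (phi : M -> M) (f : M -> R[i]) :
  holomorphic_map phi -> holomorphic f -> holomorphic (f \o phi).
Proof.
move=> [cphi hphi] hf c ac x cx.
have [c' ac' c'x] := atlas_cover (phi x).
apply: (@differentiable_near_eq _ _ _
  ((f \o chart_inv c') \o (c' \o phi \o chart_inv c))); last first.
  apply: differentiable_comp; first exact: hphi.
  by rewrite /= (chart_mapK cx); exact: hf.
have cinv : {for c x, continuous (chart_inv c)}.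
  have := @chart_inv_continuous _ _ _ c.
  rewrite continuous_open_subspace; last exact: chart_img_open.
  by apply; rewrite inE; exists x.
have cpi : {for c x, continuous (phi \o chart_inv c)}.
  exact: (continuous_comp cinv (cphi _)).
have : nbhs (phi (chart_inv c (c x))) (chart_dom c').
  by rewrite (chart_mapK cx); apply: open_nbhs_nbhs; split => //;
    exact: chart_dom_open.
move=> /cpi cpiz.
apply: (@filterS _ (nbhs (c x)) _ _ _ _ cpiz) => z /= hz.
by rewrite (chart_mapK hz).
Qed.

Section CompositionOperator.
Variables (phi : M -> M) (hphi : holomorphic_map phi).

Definition comp_op (f : holo_space) : holo_space :=
  exist _ ((\val f : M -> R[i]) \o phi)
    (mem_set (holomorphic_comp hphi (set_mem (valP f)))).

Lemma comp_op_continuous : continuous comp_op.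
Proof.
apply: set_type_continuous.
exact: (precomp_continuous hphi.1 (@set_val_continuous _ holomorphic_set)).
Qed.

Lemma comp_op_linear : linear comp_op.
Proof. by move=> a f g; apply: val_inj. Qed.

HB.instance Definition _ :=
  isContinuous.Build holo_space holo_space comp_op comp_op_continuous.

End CompositionOperator.

End Holomorphic.

Section Universality.
Variable X : topologicalType.

Lemma iter_continuous (T : continuousType X X) n : continuous (iter n T).
Proof.
elim: n => [|n IHn] x; first exact: cvg_id.
by apply: continuous_comp; [exact: IHn|exact: cts_fun].
Qed.

HB.instance Definition _ (T : continuousType X X) n :=
  isContinuous.Build X X (iter n T) (@iter_continuous T n).

Definition universal (T : nat -> continuousType X X) : Prop :=
  exists x : X, dense (range (fun l => T l x)).

Definition hereditarily_universal (T : nat -> continuousType X X) : Prop :=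
  forall k : nat -> nat, increasing_seq k -> universal (T \o k).

Definition hypercyclic_wrt (T : continuousType X X) (n : nat -> nat) : Prop :=
  universal (fun l => iter (n l) T).

Definition hereditarily_hypercyclic_wrt (T : continuousType X X)
    (n : nat -> nat) : Prop :=
  hereditarily_universal (fun l => iter (n l) T).

End Universality.

(* Main.v *)
Require Import Defs.
From HB Require Import structures.
From mathcomp Require Import all_boot all_order all_algebra.
From mathcomp Require Import complex.
From mathcomp Require Import all_classical all_reals all_analysis.
From mathcomp Require Import ring lra.

(* Let f have a dense orbit F_l = f o phi^(n_l), and let K_j be the compact
   exhaustion. Density applied to c + f, with c large, yields an increasing k
   and c_j -> +oo with f o phi^(n_(k_j)) ~ c_j + f on K_j. Iterates of phi
   commute, so F_a o phi^(n_(k_j)) ~ c_j + F_a on any compact set, for each a.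
   If F_b ~ y and F_a ~ g, the function
     z = F_b * (1 - X(f)) + (F_a - c_j) * X(f),  X(w) = 1 - (1 - (w / c_j)^2)^2,
   is then close to y, while z o phi^(n_(k_j)) is close to g. Hence the
   sequence (n_(k_j)) is mixing, and for any subsequence a universal function is
   obtained as the limit of a geometrically convergent sequence of such z.

   That the limit is holomorphic is Weierstrass' theorem. It follows from a
   Cauchy estimate |g(t) - g(0)| <= 8 M |t| on the square [-1, 1]^2, where
   holomorphy only means pointwise complex differentiability. The estimate comes
   from Goursat's bisection argument carried out on Riemann sums over boundaries
   of dyadic squares, which are additive exactly, so no integral is needed. *)

Set Implicit Arguments.
Unset Strict Implicit.
Unset Printing Implicit Defensive.

Import Order.TTheory GRing.Theory Num.Theory.
Import numFieldNormedType.Exports.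
Import Normc.

Local Open Scope classical_set_scope.
Local Open Scope ring_scope.
Local Open Scope complex_scope.

Local Notation Re := complex.Re.
Local Notation Im := complex.Im.

(** * Riemann sums over boundaries of squares *)

Section ComplexModulus.
Variable R : realType.
Implicit Types (x y : R) (z w : R[i]).

Lemma normc_ge0 z : 0 <= normc z.
Proof. by case: z => a b; exact: sqrtr_ge0. Qed.

Lemma normcD_le z w : normc (z + w) <= normc z + normc w.
Proof. exact: le_normcD. Qed.

Lemma normc_opp z : normc (- z) = normc z.
Proof. exact: normcN. Qed.

Lemma normcB_le z w : normc (z - w) <= normc z + normc w.
Proof. by rewrite -(normc_opp w) normcD_le. Qed.

Lemma normc_distC z w : normc (z - w) = normc (w - z).
Proof. by rewrite -normc_opp opprB. Qed.

Lemma normc_tri w z z' : normc (z - z') <= normc (z - w) + normc (w - z').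
Proof. by rewrite -{1}(subrK w z) -addrA normcD_le. Qed.

Lemma normcB_ge z w : normc z - normc w <= normc (z - w).
Proof. by rewrite lerBlDr -{1}(subrK w z) normcD_le. Qed.

Lemma normc_gt0 z : z != 0 -> 0 < normc z.
Proof.
move=> z0; rewrite lt_def normc_ge0 andbT.
by apply: contra z0 => /eqP/eq0_normc ->.
Qed.

Lemma normc_real x : normc x%:C = `|x|.
Proof. by rewrite /normc /= expr0n addr0 sqrtr_sqr. Qed.

Lemma normc_i : normc ('i%C : R[i]) = 1.
Proof. by rewrite /normc /= expr0n add0r expr1n sqrtr1. Qed.

Lemma normc_geRe z : `|Re z| <= normc z.
Proof.
by case: z => a b /=; rewrite -sqrtr_sqr ler_wsqrtr// lerDl sqr_ge0.
Qed.

Lemma normc_geIm z : `|Im z| <= normc z.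
Proof.
by case: z => a b /=; rewrite -sqrtr_sqr ler_wsqrtr// lerDr sqr_ge0.
Qed.

Lemma normc_leReIm z : normc z <= `|Re z| + `|Im z|.
Proof.
rewrite {1}(complexE z) (le_trans (normcD_le _ _))//.
by rewrite normcM normc_i mul1r !normc_real.
Qed.

End ComplexModulus.

Section RiemannSum.
Variable R : realType.
Implicit Types (g h : R -> R[i]) (x s : R) (c : R[i]).

(* The left Riemann sum with 2 ^ n steps; the recursion makes it exactly additive
   under bisection. *)
Fixpoint rsum n g x s : R[i] :=
  if n is n'.+1 then rsum n' g x (s / 2) + rsum n' g (x + s / 2) (s / 2)
  else g x * s%:C.

Lemma rsumD n g h x s : rsum n (g \+ h) x s = rsum n g x s + rsum n h x s.
Proof.
elim: n x s => [|n IH] x s /=; first by rewrite mulrDl.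
by rewrite !IH addrACA.
Qed.

Lemma rsumZ n c g x s : rsum n (fun u => c * g u) x s = c * rsum n g x s.
Proof.
elim: n x s => [|n IH] x s /=; first by rewrite mulrA.
by rewrite !IH mulrDr.
Qed.

Lemma eq_rsum n g h x s : g =1 h -> rsum n g x s = rsum n h x s.
Proof. by move=> gh; elim: n x s => [|n IH] x s /=; rewrite ?gh ?IH. Qed.

Lemma rsumB n g h x s : rsum n g x s - rsum n h x s = rsum n (g \- h) x s.
Proof.
rewrite -mulN1r -rsumZ -rsumD; apply: eq_rsum => u /=.
by rewrite mulN1r.
Qed.

Lemma rsum_cst n c x s : rsum n (fun=> c) x s = c * s%:C.
Proof.
elim: n x s => [|n IH] x s //=; rewrite !IH -mulrDr -rmorphD/=.
by congr (_ * _%:C); field.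
Qed.

Lemma rsum_normc_le n g x s b : 0 <= s ->
  (forall u, x <= u <= x + s -> normc (g u) <= b) ->
  normc (rsum n g x s) <= b * s.
Proof.
elim: n x s => [|n IH] x s s0 gb /=.
  by rewrite normcM normc_real ger0_norm// ler_wpM2r// gb//; lra.
apply: le_trans (normcD_le _ _) _.
have -> : b * s = b * (s / 2) + b * (s / 2) by field.
by apply: lerD; apply: IH => [|u ux]; [lra|apply: gb; lra|lra|apply: gb; lra].
Qed.

Lemma rsum_Im_ge n g x s b : 0 <= s ->
  (forall u, x <= u <= x + s -> b <= Im (g u)) ->
  b * s <= Im (rsum n g x s).
Proof.
elim: n x s => [|n IH] x s s0 gb /=.
  have := gb x; case: (g x) => a a' /=; rewrite mulr0 add0r => h.
  by rewrite ler_wpM2r// h//; lra.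
rewrite raddfD/=.
have -> : b * s = b * (s / 2) + b * (s / 2) by field.
by apply: lerD; apply: IH => [|u ux]; [lra|apply: gb; lra|lra|apply: gb; lra].
Qed.

End RiemannSum.

Section SquareSum.
Variable R : realType.
Implicit Types (g h : R[i] -> R[i]) (x y s : R) (c d : R[i]).

(* Approximates the contour integral of g along the boundary of the square with
   lower left corner (x, y) and side s. *)
Definition sqsum n g x y s : R[i] :=
  rsum n (fun u => g (u +i* y)) x s
  + 'i%C * rsum n (fun v => g ((x + s) +i* v)) y s
  - rsum n (fun u => g (u +i* (y + s))) x s
  - 'i%C * rsum n (fun v => g (x +i* v)) y s.

(** Each inner edge belongs to two neighbouring quarters with opposite orientations and the same
    sample points, so it cancels identically, without passing to a limit in [n]. *)
Lemma sqsumS n g x y s : let r := s / 2 in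
  sqsum n.+1 g x y s = sqsum n g x y r + sqsum n g (x + r) y r
    + sqsum n g x (y + r) r + sqsum n g (x + r) (y + r) r.
Proof.
move=> r; have rr t : t + s = t + r + r by rewrite -addrA -splitr.
by rewrite /sqsum /= -/r !rr; ring.
Qed.

Lemma sqsumD n g h x y s :
  sqsum n (g \+ h) x y s = sqsum n g x y s + sqsum n h x y s.
Proof. by rewrite /sqsum !rsumD; ring. Qed.

Lemma sqsumZ n c g x y s :
  sqsum n (fun z => c * g z) x y s = c * sqsum n g x y s.
Proof. by rewrite /sqsum !rsumZ; ring. Qed.

Lemma sqsumB n g h x y s :
  sqsum n (g \- h) x y s = sqsum n g x y s - sqsum n h x y s.
Proof. by rewrite /sqsum -!rsumB; ring. Qed.

Lemma eq_sqsum n g h x y s : g =1 h -> sqsum n g x y s = sqsum n h x y s.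
Proof. by move=> gh; congr sqsum; apply: funext. Qed.

(** Opposite sides are sampled at translated points, so each pair contributes a constant difference,
    and the two constants cancel. Being exact for every [n], this lets a linear approximation be
    subtracted at no cost. *)
Lemma sqsum_affine n c d x y s : sqsum n (fun z => c + d * z) x y s = 0.
Proof.
rewrite /sqsum.
have -> (a b a' b' : R[i]) :
    a + 'i%C * b - a' - 'i%C * b' = (a - a') + 'i%C * (b - b').
  by ring.
rewrite !rsumB.
have dx u : (fun u => c + d * (u +i* y)) u - (fun u => c + d * (u +i* (y + s))) u
    = - (d * 'i%C * s%:C).
  have -> : u +i* (y + s) = (u +i* y) + 'i%C * s%:C by simpc.
  by ring.
have dy v : (fun v => c + d * ((x + s) +i* v)) v - (fun v => c + d * (x +i* v)) v
    = d * s%:C.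
  have -> : (x + s) +i* v = (x +i* v) + s%:C by simpc.
  by ring.
rewrite (eq_rsum _ _ _ dx) (eq_rsum _ _ _ dy) !rsum_cst.
by ring.
Qed.

(** The bound on [g] is asked on the boundary only, so that functions with a pole inside the square
    are covered. *)
Lemma sqsum_normc_le n g x y s b : 0 <= s ->
  (forall u v, x <= u <= x + s -> y <= v <= y + s ->
     [|| u == x, u == x + s, v == y | v == y + s] -> normc (g (u +i* v)) <= b) ->
  normc (sqsum n g x y s) <= 4 * b * s.
Proof.
move=> s0 gb; rewrite /sqsum.
have -> : 4 * b * s = b * s + b * s + b * s + b * s by ring.
apply: le_trans (normcB_le _ _) _; apply: lerD; last first.
  rewrite normcM normc_i mul1r; apply: rsum_normc_le => // v yv.
  by apply: gb; rewrite ?eqxx//; lra.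
apply: le_trans (normcB_le _ _) _; apply: lerD; last first.
  apply: rsum_normc_le => // u xu.
  by apply: gb; rewrite ?eqxx ?orbT//; lra.
apply: le_trans (normcD_le _ _) _; apply: lerD.
  apply: rsum_normc_le => // u xu.
  by apply: gb; rewrite ?eqxx ?orbT//; lra.
rewrite normcM normc_i mul1r; apply: rsum_normc_le => // v yv.
by apply: gb; rewrite ?eqxx ?orbT//; lra.
Qed.

End SquareSum.

Section Bisection.
Variable R : realType.

Definition in_square (x y s : R) (z : R[i]) : Prop :=
  x <= Re z <= x + s /\ y <= Im z <= y + s.

(** If [P] failed, choosing a failing quarter again and again would give nested squares shrinking to
    a point [p], and the local hypothesis at [p] would contradict the failure. *)
Lemma square_bisection (P : R -> R -> R -> Prop) (x y s : R) : 0 < s ->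
  (forall x y s, 0 < s ->
     P x y (s / 2) -> P (x + s / 2) y (s / 2) ->
     P x (y + s / 2) (s / 2) -> P (x + s / 2) (y + s / 2) (s / 2) -> P x y s) ->
  (forall p, in_square x y s p -> exists2 d, 0 < d &
     forall x' y' s', 0 < s' < d -> in_square x' y' s' p ->
       (forall z, in_square x' y' s' z -> in_square x y s z) -> P x' y' s') ->
  P x y s.
Proof.
move=> s0 Pstep Ploc; apply: contrapT => nP.
pose T := (R * R)%type.
pose r k : R := s / 2 ^+ k.
have r0 k : 0 < r k by rewrite divr_gt0// exprn_gt0.
have rS k : r k.+1 = r k / 2 by rewrite /r exprSr invfM mulrA.
(* [F] maps the corner of a failing square of side [r k] to the lower left corner of a failing
   quarter; [(0, 0)] is a default for squares where [P] holds. *)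
have /choice[F FP] : forall q : nat * T, exists t : T, ~ P q.2.1 q.2.2 (r q.1) ->
    [/\ ~ P t.1 t.2 (r q.1.+1),
        q.2.1 <= t.1 <= q.2.1 + r q.1.+1 &
        q.2.2 <= t.2 <= q.2.2 + r q.1.+1].
  move=> -[k [a b]] /=.
  have [Pk|nPk] := pselect (P a b (r k)); first by exists (0, 0) => /(_ Pk).
  have rk0 := r0 k.+1.
  have [P1|nP1] := pselect (P a b (r k.+1)); last first.
    by exists (a, b) => _ /=; split=> //; lra.
  have [P2|nP2] := pselect (P (a + r k.+1) b (r k.+1)); last first.
    by exists (a + r k.+1, b) => _ /=; split=> //; lra.
  have [P3|nP3] := pselect (P a (b + r k.+1) (r k.+1)); last first.
    by exists (a, b + r k.+1) => _ /=; split=> //; lra.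
  exists (a + r k.+1, b + r k.+1) => _ /=; split; [|lra|lra] => P4.
  by apply: nPk; apply: Pstep => //; rewrite -?rS.
pose q := fix q k : T := if k is k'.+1 then F (k', q k') else (x, y).
have qP k : ~ P (q k).1 (q k).2 (r k).
  elim: k => [|k IH] /=; first by rewrite /r expr0 divr1.
  by have [] := FP (k, q k) IH.
have qS k : (q k).1 <= (q k.+1).1 <= (q k).1 + r k.+1 /\
    (q k).2 <= (q k.+1).2 <= (q k).2 + r k.+1.
  by have [] := FP (k, q k) (qP k).
(* Per coordinate, the common point of the nested intervals is the supremum of the left
   endpoints. *)
have nested (c : nat -> R) : (forall k, c k <= c k.+1 <= c k + r k.+1) ->
    exists p, forall k, c k <= p <= c k + r k.
  move=> cS.
  have cD k j : c k <= c (k + j)%N /\ c (k + j)%N + r (k + j)%N <= c k + r k.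
    elim: j => [|j [IH1 IH2]]; first by rewrite addn0.
    by have := cS (k + j)%N; rewrite addnS; have := rS (k + j)%N; split; lra.
  have ub k : ubound (range c) (c k + r k).
    move=> _ [j _ <-].
    have [_] := cD k j; have [+ _] := cD j k; rewrite addnC.
    by have := r0 (k + j)%N; lra.
  exists (sup (range c)) => k; apply/andP; split.
    apply: ub_le_sup; last by exists k.
    by exists (c 0%N + r 0%N); exact: ub.
  by apply: ge_sup; [exists (c 0%N); exists 0%N|exact: ub].
have [p pP] := nested (fun k => (q k).1) (fun k => (qS k).1).
have [p' p'P] := nested (fun k => (q k).2) (fun k => (qS k).2).
have r00 : r 0%N = s by rewrite /r expr0 divr1.
have [|d d0 dP] := Ploc (p +i* p').
  by move: (pP 0%N) (p'P 0%N); rewrite r00.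
have [k kd] : exists k, r k < d.
  exists (Num.truncn (s / d)).+1.
  rewrite /r ltr_pdivrMr ?exprn_gt0// mulrC -ltr_pdivrMr//.
  apply: lt_trans (truncnS_gt (s / d)) _.
  by rewrite -natrX ltr_nat ltn_expl.
apply: (qP k); apply: dP.
- by rewrite r0.
- by split; [exact: pP|exact: p'P].
have sub j : x <= (q j).1 /\ (q j).1 + r j <= x + s /\
    y <= (q j).2 /\ (q j).2 + r j <= y + s.
  elim: j => [|j [IH1 [IH2 [IH3 IH4]]]]; first by rewrite r00 /=; lra.
  by have := qS j; have := rS j; do ![split]; lra.
by have := sub k => subk z [zx zy]; split; lra.
Qed.

End Bisection.

(** * Goursat's theorem and the Cauchy estimate *)

Section Goursat.
Variable R : realType.
Implicit Types (g : R[i] -> R[i]) (z w t : R[i]) (x y s e : R).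

Definition cdiff_at g z := exists d, forall e, 0 < e -> exists2 r, 0 < r &
  forall w, normc w < r -> normc (g (z + w) - g z - d * w) <= e * normc w.

Lemma in_square_dist x y s z w :
  in_square x y s z -> in_square x y s w -> normc (z - w) <= 2 * s.
Proof.
move=> [zx zy] [wx wy]; apply: le_trans (normc_leReIm _) _.
have -> : 2 * s = s + s by ring.
by case: z w zx zy wx wy => [a b] [a' b'] /= *; apply: lerD; rewrite ler_norml; lra.
Qed.

(* The number of half-lines issued from a that start inside [x, x + s]; unlike
   the indicator of [x, x + s] it is additive under bisection. *)
Definition sides (a x s : R) : R :=
  (x <= a < x + s)%R%:R + (x < a <= x + s)%R%:R.

Lemma sides_split a x s : 0 < s ->
  sides a x s = sides a x (s / 2) + sides a (x + s / 2) (s / 2).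
Proof.
move=> s0; rewrite /sides.
have -> : x + s / 2 + s / 2 = x + s by field.
have [ax|xa|ax] := ltgtP a x; have [am|ma|am] := ltgtP a (x + s / 2);
  have [as_|sa|as_] := ltgtP a (x + s); rewrite /= ?andbF ?andbT //; lra.
Qed.

Lemma sides_ge1 a x s : 0 < s -> x <= a <= x + s -> 1 <= sides a x s.
Proof.
move=> s0 /andP[xa ax]; rewrite /sides xa ax /=.
have [->|ax'] := eqVneq a (x + s).
  by rewrite ltxx add0r ltrDl s0.
by rewrite lt_neqAle ax' ax /= lerDl ler0n.
Qed.

Lemma sides_ge0 a x s : 0 <= sides a x s.
Proof. by rewrite addr_ge0. Qed.

(* Bisection compares the sums with the additive function mu of squares. Near the
   exceptional point t, mu stays at least 1 on every square containing t, while
   the sums tend to 0 because g is bounded there. *)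
Lemma goursat g x y s t r B : 0 < s -> 0 < r ->
  (forall z, in_square x y s z -> z <> t -> cdiff_at g z) ->
  (forall z, normc (z - t) < r -> normc (g z) <= B) ->
  forall e, 0 < e -> exists n0, forall n, (n0 <= n)%N ->
    normc (sqsum n g x y s) <= e.
Proof.
move=> s0 r0 gd gB e e0.
pose mu x y s := s ^+ 2 + sides (Re t) x s * sides (Im t) y s.
have mu_ge0 x' y' s' : 0 <= mu x' y' s'.
  by rewrite addr_ge0 ?sqr_ge0 ?mulr_ge0 ?sides_ge0.
have muE : 0 < mu x y s.
  by rewrite ltr_wpDr ?exprn_gt0 ?mulr_ge0 ?sides_ge0.
pose k := e / mu x y s.
have k0 : 0 < k by rewrite divr_gt0.
suff : exists n0, forall n, (n0 <= n)%N ->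
    normc (sqsum n g x y s) <= k * mu x y s.
  by rewrite /k divfK// gt_eqF.
pose P x y s := exists n0, forall n, (n0 <= n)%N ->
  normc (sqsum n g x y s) <= k * mu x y s.
apply: (@square_bisection R P) => //.
  move=> {gd muE s0} x' y' s' s0 [n1 H1] [n2 H2] [n3 H3] [n4 H4].
  exists (maxn (maxn n1 n2) (maxn n3 n4)).+1 => -[//|n].
  rewrite ltnS !geq_max => /andP[/andP[l1 l2] /andP[l3 l4]].
  rewrite sqsumS /=.
  have -> : k * mu x' y' s' =
      k * mu x' y' (s' / 2) + k * mu (x' + s' / 2) y' (s' / 2)
      + k * mu x' (y' + s' / 2) (s' / 2)
      + k * mu (x' + s' / 2) (y' + s' / 2) (s' / 2).
    rewrite /mu (sides_split (Re t) x' s0) (sides_split (Im t) y' s0).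
    by field.
  apply: le_trans (normcD_le _ _) _; apply: lerD _ (H4 _ l4).
  apply: le_trans (normcD_le _ _) _; apply: lerD _ (H3 _ l3).
  by apply: le_trans (normcD_le _ _) _; apply: lerD; [exact: H1|exact: H2].
move=> p pS; have [pt|pt] := pselect (p = t).
  (* Points of a square of side [s'] containing [t] lie within [2 * s'] of [t], hence the bound
     [r / 2]. The other bound makes the sum at most [k], and [mu] is at least 1 there. *)
  pose d := Num.min (r / 2) (k / (4 * (`|B| + 1))).
  have B0 : 0 < `|B| + 1 by rewrite ltr_wpDl.
  exists d; first by rewrite lt_min !divr_gt0// mulr_gt0.
  move=> x' y' s' /andP[s'0]; rewrite lt_min => /andP[s'r s'k] pS' _.
  exists 0%N => n _.
  have /le_trans -> // : normc (sqsum n g x' y' s') <= 4 * (`|B| + 1) * s'.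
    apply: sqsum_normc_le; first lra.
    move=> u v xu yv _; apply: le_trans (gB _ _) _; last first.
      by rewrite (le_trans (ler_norm B))// lerDl.
    rewrite -pt.
    have : in_square x' y' s' (u +i* v) by split.
    by move=> /in_square_dist/(_ pS'); lra.
  move: s'k; rewrite ltr_pdivlMr ?mulr_gt0// => s'k.
  rewrite mulrC (le_trans (ltW s'k))// ler_peMr ?(ltW k0)// /mu.
  case: pS'; rewrite pt => /(sides_ge1 s'0) sx /(sides_ge1 s'0) sy.
  by have := sqr_ge0 s'; nra.
have [d gd'] := gd p pS pt.
(* After the affine part is subtracted, the error on the boundary is at most [k / 8 * (2 * s')];
   four sides of length [s'] then give exactly [k * s' ^+ 2]. *)
have [|q q0 qP] := gd' (k / 8); first by rewrite divr_gt0.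
exists (q / 2) => [|x' y' s' /andP[s'0 s'q] pS' _]; first lra.
exists 0%N => n _.
pose h z := g z - ((g p - d * p) + d * z).
have -> : sqsum n g x' y' s' = sqsum n h x' y' s'.
  rewrite -[RHS]addr0 -[X in _ = _ + X](sqsum_affine n (g p - d * p) d x' y' s').
  by rewrite -sqsumD; apply: eq_sqsum => z /=; rewrite /h subrK.
have /le_trans -> // : normc (sqsum n h x' y' s') <= 4 * (k / 8 * (2 * s')) * s'.
  apply: sqsum_normc_le; first lra.
  move=> u v xu yv _.
  have zS : in_square x' y' s' (u +i* v) by split.
  have pz := in_square_dist zS pS'.
  have := qP ((u +i* v) - p).
  rewrite [p + _]addrC subrK.
  have -> : h (u +i* v) = g (u +i* v) - g p - d * ((u +i* v) - p).
    by rewrite /h; ring.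
  move=> /(_ _)/le_trans -> //; first by lra.
  by rewrite ler_wpM2l// divr_ge0// ltW.
rewrite /mu mulrDr.
have -> : 4 * (k / 8 * (2 * s')) * s' = k * s' ^+ 2 by field.
by rewrite lerDl mulr_ge0 ?(ltW k0) ?mulr_ge0 ?sides_ge0.
Qed.

(** Its value at [z = t] is 0 by the convention on division; Goursat's argument only needs
    boundedness near [t]. *)
Definition dquot g t z := (g z - g t) / (z - t).

Lemma cdiff_dquot g t z : cdiff_at g z -> z <> t -> cdiff_at (dquot g t) z.
Proof.
move=> [d gd] zt; set a := z - t.
have a0 : a != 0 by rewrite subr_eq0; apply/eqP.
have na0 := normc_gt0 a0.
(* The derivative given by the quotient rule. *)
pose D := (d - (g z - g t) / a) / a.
exists D => e e0.
have [|r r0 rP] := gd (e * normc a / 4); first by rewrite divr_gt0// mulr_gt0.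
(* The three bounds control the expansion of [g], keep [a + w] away from 0, and make the remainder
   [D * w * w / (a + w)] at most [e / 2 * normc w]. *)
exists (Num.min r (Num.min (normc a / 2) (e * normc a / (4 * (normc D + 1))))).
  have D0 : 0 < normc D + 1 by rewrite ltr_wpDl ?normc_ge0.
  by rewrite !lt_min r0 !divr_gt0 ?mulr_gt0.
move=> w; rewrite !lt_min => /and3P[wr wa wD].
have D0 : 0 < normc D + 1 by rewrite ltr_wpDl ?normc_ge0.
have naw : normc a / 2 <= normc (a + w).
  by have := normcB_ge a (- w); rewrite opprK normc_opp; lra.
have aw0 : a + w != 0.
  by apply/eqP => aw; move: naw; rewrite aw normc0; lra.
have -> : dquot g t (z + w) - dquot g t z - D * w =
    (g (z + w) - g z - d * w) / (a + w) - D * w * w / (a + w).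
  rewrite /dquot -/a.
  have -> : z + w - t = a + w by rewrite /a addrAC.
  by rewrite /D; field; rewrite a0 aw0.
have inv : normc (a + w)^-1 <= 2 / normc a.
  rewrite normcV -[2 / normc a]invf_div lef_pV2// posrE ?divr_gt0//.
  by apply: lt_le_trans naw; rewrite divr_gt0.
apply: le_trans (normcB_le _ _) _.
have -> : e * normc w = e / 2 * normc w + e / 2 * normc w by field.
have w0 := normc_ge0 w.
apply: lerD; rewrite normcM.
  apply: le_trans (ler_pM (normc_ge0 _) (normc_ge0 _) (rP _ wr) inv) _.
  by rewrite le_eqVlt; apply/orP; left; apply/eqP; field; rewrite gt_eqF.
rewrite !normcM.
have wD' : normc D * normc w <= e * normc a / 4.
  move: wD; rewrite ltr_pdivlMr ?mulr_gt0// => wD.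
  by have := normc_ge0 D; nra.
have := ler_pM (mulr_ge0 (normc_ge0 D) w0) (normc_ge0 _) wD' inv.
have -> : e * normc a / 4 * (2 / normc a) = e / 2 by field; rewrite gt_eqF.
by move=> /(ler_wpM2r w0) le2; rewrite [X in X <= _]mulrAC -[_ * normc a^-1]normcM.
Qed.

Lemma dquot_locally_bounded g t : cdiff_at g t ->
  exists r B, 0 < r /\ forall z, normc (z - t) < r -> normc (dquot g t z) <= B.
Proof.
move=> [d gd]; have [r r0 rP] := gd 1 ltr01.
exists r, (1 + normc d); split=> // z zr.
have [->|zt] := eqVneq z t.
  by rewrite /dquot !subrr mul0r normc0 addr_ge0 ?normc_ge0.
have zt0 : z - t != 0 by rewrite subr_eq0.
rewrite /dquot normcM normcV ler_pdivrMr ?normc_gt0//.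
have := rP _ zr; rewrite [t + _]addrC subrK => rz.
have -> : g z - g t = (g z - g t - d * (z - t)) + d * (z - t) by ring.
by apply: le_trans (normcD_le _ _) _; rewrite normcM mulrDl; lra.
Qed.

(** A lower bound in place of the exact contour integral of 1/z. On each side the integrand, with
    its orientation factor, has imaginary part 1 / (u^2 + 1) >= 1/2, and the total length is 8. *)
Lemma sqsum_inv_ge n : 4 <= normc (sqsum n (fun z => z^-1) (-1) (-1) (2 : R)).
Proof.
apply: le_trans (normc_geIm _); apply: le_trans (ler_norm _).
rewrite /sqsum.
have -> (a b c d : R[i]) : a + 'i%C * b - c - 'i%C * d =
    a + 'i%C * b + (-1) * c + (- 'i%C) * d.
  by ring.
rewrite -!rsumZ !raddfD/=.
have e : -1 + 2 = 1 :> R by lra.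
rewrite e.
have bnd (u : R) : -1 <= u <= 1 -> 1 / 2 <= 1 / (u ^+ 2 + 1).
  move=> u1; have u2 : 0 < u ^+ 2 + 1 by rewrite ltr_wpDl ?sqr_ge0.
  by rewrite ler_pdivlMr//; nra.
have -> : 4 = 1 / 2 * 2 + 1 / 2 * 2 + 1 / 2 * 2 + 1 / 2 * 2 :> R by lra.
by do ![apply: lerD]; apply: rsum_Im_ge => // u; rewrite e => /bnd/le_trans -> //=;
  rewrite le_eqVlt; apply/orP; left; apply/eqP;
  simpc; rewrite ?sqrrN ?expr1n ?opprK ?mul0r ?mul1r ?mulN1r ?opprK;
  rewrite ?addr0 ?add0r // [1 + _]addrC.
Qed.

(** An approximate Cauchy formula: Goursat applied to [dquot g p] compares [g p] times the sum of
    1/(z - p) with the sum of g/(z - p). Taking the difference for [p = t] and [p = 0] and dividing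
    by the lower bound 4 for the sum of 1/z gives the estimate. *)
Lemma unit_square_lipschitz g M t :
  (forall z, in_square (-1) (-1) 2 z -> cdiff_at g z) ->
  (forall z, in_square (-1) (-1) 2 z -> normc (g z) <= M) ->
  normc t <= 1 / 2 -> normc (g t - g 0) <= 8 * M * normc t.
Proof.
move=> gd gM t2.
have tS : in_square (-1) (-1) 2 t.
  by have := normc_geRe t; have := normc_geIm t; rewrite !ler_norml; split; lra.
have zS : in_square (-1) (-1) 2 (0 : R[i]) by split=> /=; lra.
have M0 : 0 <= M by apply: le_trans (normc_ge0 _) (gM _ zS).
pose I n h := sqsum n h (-1) (-1) (2 : R).
have cauchy p : in_square (-1) (-1) 2 p -> forall e, 0 < e ->
    exists n0, forall n, (n0 <= n)%N -> normc (I n (dquot g p)) <= e.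
  move=> pS; have [r [B [r0 rB]]] := dquot_locally_bounded (gd p pS).
  apply: (goursat _ r0 _ rB) => // z zS' zp; apply: cdiff_dquot => //.
  exact: gd.
have IE n p : I n (dquot g p) =
    I n (fun z => g z / (z - p)) - g p * I n (fun z => (z - p)^-1).
  by rewrite /I -sqsumZ -sqsumB; apply: eq_sqsum => z /=; rewrite /dquot mulrBl.
(* On the boundary |z| >= 1 and |z - t| >= 1/2, so the denominator of t / ((z - t) z) is at least
   1/2. *)
have bd u v : -1 <= u <= -1 + 2 -> -1 <= v <= -1 + 2 ->
    [|| u == -1, u == -1 + 2, v == -1 | v == -1 + 2] ->
    normc ((u +i* v - t)^-1 - (u +i* v)^-1) <= 2 * normc t.
  move=> u1 v1 uv.
  have z1 : 1 <= normc (u +i* v).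
    have := normc_geRe (u +i* v); have := normc_geIm (u +i* v) => /=.
    rewrite !ler_norml.
    by case/or4P: uv => /eqP ->; lra.
  have zt : 1 / 2 <= normc (u +i* v - t).
    by have := normcB_ge (u +i* v) t; lra.
  have z0 : u +i* v != 0 by apply/eqP => z0; move: z1; rewrite z0 normc0; lra.
  have zt0 : u +i* v - t != 0.
    by apply/eqP => z0'; move: zt; rewrite z0' normc0; lra.
  have -> : (u +i* v - t)^-1 - (u +i* v)^-1 = t / ((u +i* v - t) * (u +i* v)).
    by field; rewrite z0 zt0.
  rewrite normcM mulrC ler_wpM2r ?normc_ge0// normcV normcM.
  rewrite -[2]invrK lef_pV2 ?posrE ?invr_gt0//; last by rewrite mulr_gt0//; lra.
  by nra.
have D1 n : normc (I n (fun z => (z - t)^-1) - I n (fun z => z^-1)) <=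
    16 * normc t.
  rewrite /I -sqsumB.
  have -> : 16 * normc t = 4 * (2 * normc t) * 2 by ring.
  exact: sqsum_normc_le.
have D2 n : normc (I n (fun z => g z / (z - t)) - I n (fun z => g z / z)) <=
    16 * M * normc t.
  rewrite /I -sqsumB.
  have -> : 16 * M * normc t = 4 * (M * (2 * normc t)) * 2 by ring.
  apply: sqsum_normc_le => // u v u1 v1 uv.
  have -> : ((fun z => g z / (z - t)) \- (fun z => g z / z)) (u +i* v) =
      g (u +i* v) * ((u +i* v - t)^-1 - (u +i* v)^-1) by rewrite mulrBr.
  by rewrite normcM ler_pM ?normc_ge0//; [exact: gM|exact: bd].
apply/ler_addgt0Pr => e e0.
have [n1 H1] := cauchy t tS (2 * e) ltac:(lra).
have [n2 H2] := cauchy 0 zS (2 * e) ltac:(lra).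
pose n := maxn n1 n2.
have {}H1 : normc (I n (dquot g t)) <= 2 * e by apply: H1; rewrite leq_maxl.
have {}H2 : normc (I n (dquot g 0)) <= 2 * e by apply: H2; rewrite leq_maxr.
rewrite IE in H1; rewrite IE in H2.
have E0 (h : R[i] -> R[i]) : I n (fun z => h (z - 0)) = I n h.
  by apply: eq_sqsum => z; rewrite subr0.
rewrite (E0 (fun z => z^-1)) in H2.
have E1 : I n (fun z => g z / (z - 0)) = I n (fun z => g z / z).
  by apply: eq_sqsum => z; rewrite subr0.
rewrite E1 in H2.
(* Moving the pole costs [16 * M * normc t] twice, by [D1] and [D2]; the two Goursat errors cost
   [2 * e] each. *)
have main : normc ((g t - g 0) * I n (fun z => z^-1)) <= 32 * M * normc t + 4 * e.
  set J := I n (fun z => z^-1); set Jt := I n (fun z => (z - t)^-1).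
  set G := I n (fun z => g z / z); set Gt := I n (fun z => g z / (z - t)).
  have -> : (g t - g 0) * J = g t * (J - Jt) - (Gt - g t * Jt) + (Gt - G)
      + (G - g 0 * J) by ring.
  have := normcD_le (g t * (J - Jt) - (Gt - g t * Jt) + (Gt - G)) (G - g 0 * J).
  have := normcD_le (g t * (J - Jt) - (Gt - g t * Jt)) (Gt - G).
  have := normcB_le (g t * (J - Jt)) (Gt - g t * Jt).
  have : normc (g t * (J - Jt)) <= 16 * M * normc t.
    rewrite normcM normc_distC -mulrA mulrCA.
    by rewrite ler_pM ?normc_ge0//; [exact: gM|exact: D1].
  by have := D2 n; rewrite -/Gt -/G; lra.
have := sqsum_inv_ge n; rewrite -/(I n _) => J4.
move: main; rewrite normcM => main.
have := ler_wpM2l (normc_ge0 (g t - g 0)) J4.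
by lra.
Qed.

End Goursat.

(** * Limits of differentiable functions *)

Section RealNorm.
Variables (R : realType) (V : normedModType R[i]).
Implicit Types v : V.

(* The norm of V takes values in R[i]; vnorm is the same norm, in R. *)
Definition vnorm v : R := Re `|v|.

Lemma vnormE v : `|v| = (vnorm v)%:C.
Proof. by rewrite /vnorm RRe_real// normr_real. Qed.

Lemma vnorm_ge0 v : 0 <= vnorm v.
Proof. by rewrite -lecR -vnormE normr_ge0. Qed.

Lemma vnorm0 : vnorm 0 = 0.
Proof. by rewrite /vnorm normr0. Qed.

Lemma vnorm_gt0 v : v != 0 -> 0 < vnorm v.
Proof. by rewrite -normr_gt0 vnormE ltcR. Qed.

Lemma normcE z : `|z| = (normc z)%:C :> R[i].
Proof. by case: z. Qed.

Lemma vnormZ (z : R[i]) v : vnorm (z *: v) = normc z * vnorm v.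
Proof.
apply: (@complexI R); rewrite rmorphM/=.
by rewrite -!vnormE normrZ normcE.
Qed.

Lemma gt0_complex (e : R[i]) : 0 < e -> exists2 r : R, 0 < r & e = r%:C.
Proof.
move=> e0; have er : e \is Num.real by rewrite gtr0_real.
by exists (Re e); [rewrite -ltcR|]; rewrite RRe_real.
Qed.

Lemma nbhs_vnormP (a : V) (A : set V) :
  nbhs a A <-> exists2 r : R, 0 < r & forall v, vnorm v < r -> A (a + v).
Proof.
split=> [/nbhs_normP[e /= /gt0_complex[r r0 ->]] rA|[r r0 rA]].
  exists r => // v vr; apply: rA => /=.
  by rewrite opprD addNKr normrN vnormE ltcR.
apply/nbhs_normP; exists r%:C => /=; first by rewrite ltcR.
move=> v /=; rewrite distrC vnormE ltcR => /rA.
by rewrite addrC subrK.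
Qed.

Lemma differentiable_epsP (u : V -> R[i]) (a : V) : differentiable u a <->
  exists2 L : {linear V -> R[i]}, continuous L &
    forall e : R, 0 < e -> exists2 r : R, 0 < r & forall v, vnorm v < r ->
      normc (u (a + v) - u a - L v) <= e * vnorm v.
Proof.
split.
  move=> /diff_locallyP[cL]; set L := 'd u a => /eqaddoP dL.
  exists L => // e e0.
  have /dL /nbhs_vnormP[r r0 rL] : 0 < e%:C :> R[i] by rewrite ltcR.
  exists r => // v /rL; rewrite add0r /= vnormE normcE -rmorphM/= lecR.
  by rewrite !fctE /= [v + a]addrC opprD addrA.
move=> [L cL dL].
have dL' : u \o shift a = cst (u a) + L +o_ 0 id.
  apply/eqaddoP => _ /gt0_complex[e e0 ->].
  have [r r0 rL] := dL e e0.
  apply/nbhs_vnormP; exists r => // v /rL.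
  rewrite add0r /= vnormE normcE -rmorphM/= lecR.
  by rewrite !fctE /= [v + a]addrC opprD addrA.
by apply/diff_locallyP; rewrite (diff_unique cL dL').
Qed.

End RealNorm.

Section CauchyEstimate.
Variables (R : realType) (V : normedModType R[i]).

Lemma line_cdiff_at (u : V -> R[i]) (a w : V) (z : R[i]) :
  differentiable u (a + z *: w) -> cdiff_at (fun t => u (a + t *: w)) z.
Proof.
move=> /differentiable_epsP[L _ dL]; exists (L w) => e e0.
pose k := vnorm w + 1.
have k0 : 0 < k by rewrite ltr_wpDl// vnorm_ge0.
have [|r r0 rL] := dL (e / k); first by rewrite divr_gt0.
exists (r / k) => [|t tr]; first by rewrite divr_gt0.
have tk : normc t * k < r by rewrite -ltr_pdivlMr.
have wk : vnorm (t *: w) <= normc t * k.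
  by rewrite vnormZ ler_wpM2l ?normc_ge0// lerDl.
rewrite scalerDl addrA mulrC -[t * _]/(t *: L w) -linearZ.
apply: le_trans (rL _ (le_lt_trans wk tk)) _.
apply: le_trans (ler_wpM2l _ wk) _; first by rewrite divr_ge0 ?ltW.
by rewrite mulrCA divfK ?gt_eqF// mulrC.
Qed.

(** The one-variable estimate on the complex line through [a] in direction [v]. With
    [vnorm w = r / 4] the square [-1, 1]^2 stays in the ball of radius [r], and [v] is [t *: w] with
    [t] of modulus [4 * vnorm v / r], at most 1/2. *)
Lemma bounded_differentiable_lipschitz (u : V -> R[i]) (a : V) (r M : R) :
  0 < r ->
  (forall v, vnorm v < r -> differentiable u (a + v)) ->
  (forall v, vnorm v < r -> normc (u (a + v)) <= M) ->
  forall v, vnorm v <= r / 8 ->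
    normc (u (a + v) - u a) <= 32 * M / r * vnorm v.
Proof.
move=> r0 ud uM v vr.
have [->|v0] := eqVneq v 0.
  by rewrite addr0 subrr normc0 vnorm0 mulr0.
have nv0 := vnorm_gt0 v0.
pose w := (r / (4 * vnorm v))%:C *: v.
have nw : vnorm w = r / 4.
  rewrite vnormZ normc_real ger0_norm; first by field; rewrite gt_eqF.
  by rewrite divr_ge0 ?mulr_ge0 ?ltW.
have sq z : in_square (-1) (-1) 2 z -> vnorm (z *: w) < r.
  case=> zx zy; rewrite vnormZ nw.
  have : normc z <= 2.
    apply: le_trans (normc_leReIm _) _.
    have -> : 2 = 1 + 1 :> R by ring.
    by apply: lerD; rewrite ler_norml; lra.
  by move=> z2; nra.
pose t : R[i] := (4 * vnorm v / r)%:C.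
have nt : normc t = 4 * vnorm v / r.
  by rewrite normc_real ger0_norm// divr_ge0 ?mulr_ge0 ?ltW.
have tw : t *: w = v.
  rewrite scalerA -rmorphM/=.
  have -> : 4 * vnorm v / r * (r / (4 * vnorm v)) = 1.
    by field; rewrite !gt_eqF.
  by rewrite scale1r.
have := @unit_square_lipschitz R (fun t => u (a + t *: w)) M t.
rewrite tw scale0r addr0 nt => lip.
have -> : 32 * M / r * vnorm v = 8 * M * (4 * vnorm v / r).
  by field; rewrite gt_eqF.
apply: lip.
- by move=> z /sq zr; apply: line_cdiff_at; exact: ud.
- by move=> z /sq zr; exact: uM.
- by rewrite ler_pdivrMr//; lra.
Qed.

End CauchyEstimate.

Section GeometricLimit.
Variable R : realType.

Lemma le_geometric (C x y : R) :
  (forall i : nat, x <= y + C / 2 ^+ i) -> x <= y.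
Proof.
move=> H; apply/ler_addgt0Pr => e e0.
have [C0|C0] := leP C 0.
  by have := H 0%N; rewrite expr0 divr1; lra.
have := H (Num.truncn (C / e)).+1; move=> /le_trans -> //.
rewrite lerD2l ler_pdivrMr ?exprn_gt0// mulrC -ler_pdivrMr// ltW//.
apply: lt_trans (truncnS_gt (C / e)) _.
by rewrite -natrX ltr_nat ltn_expl.
Qed.

(** The intervals of radius [2 * B / 2 ^+ i] around [x i] are nested; the supremum of their left
    endpoints lies in all of them. *)
Lemma geometric_real_limit (x : nat -> R) (B : R) :
  (forall i, `|x i.+1 - x i| <= B / 2 ^+ i) ->
  exists l, forall i, `|l - x i| <= 2 * B / 2 ^+ i.
Proof.
move=> xB.
pose r i := 2 * B / 2 ^+ i.
have rS i : r i = 2 * r i.+1.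
  by rewrite /r exprS; field; rewrite expf_neq0//.
have xr i : x i - r i <= x i.+1 - r i.+1 /\ x i.+1 + r i.+1 <= x i + r i.
  have := xB i; rewrite ler_norml.
  have -> : B / 2 ^+ i = r i.+1.
    by rewrite /r exprS; field; rewrite expf_neq0.
  by have := rS i; lra.
have B0 : 0 <= B.
  by have := le_trans (normr_ge0 _) (xB 0%N); rewrite expr0 divr1.
have r0 i : 0 <= r i by rewrite divr_ge0 ?mulr_ge0 ?exprn_ge0.
have mono i j : x i - r i <= x (i + j)%N - r (i + j)%N /\
    x (i + j)%N + r (i + j)%N <= x i + r i.
  elim: j => [|j [IH1 IH2]]; first by rewrite addn0.
  by rewrite addnS; have := xr (i + j)%N; lra.
have ub i : ubound (range (fun i => x i - r i)) (x i + r i).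
  move=> _ [j _ <-]; have [_] := mono i j; have [+ _] := mono j i.
  by rewrite addnC; have := r0 (i + j)%N; lra.
exists (sup (range (fun i => x i - r i))) => i.
rewrite ler_distl; apply/andP; split.
  apply: ub_le_sup; last by exists i.
  by exists (x 0%N + r 0%N); exact: ub.
by apply: ge_sup; [exists (x 0%N - r 0%N); exists 0%N|exact: ub].
Qed.

Lemma geometric_limit (z : nat -> R[i]) (B : R) :
  (forall i, normc (z i.+1 - z i) <= B / 2 ^+ i) ->
  exists l, forall i, normc (l - z i) <= 4 * B / 2 ^+ i.
Proof.
move=> zB.
have [|a aP] := @geometric_real_limit (fun i => Re (z i)) B.
  by move=> i; apply: le_trans (zB i); rewrite -raddfB; exact: normc_geRe.
have [|b bP] := @geometric_real_limit (fun i => Im (z i)) B.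
  by move=> i; apply: le_trans (zB i); rewrite -raddfB; exact: normc_geIm.
exists (a +i* b) => i; apply: le_trans (normc_leReIm _) _.
have -> : 4 * B / 2 ^+ i = 2 * B / 2 ^+ i + 2 * B / 2 ^+ i.
  by field; rewrite expf_neq0.
by apply: lerD; rewrite raddfB; [exact: aP|exact: bP].
Qed.

End GeometricLimit.

Section Weierstrass.
Variables (R : realType) (V : normedModType R[i]).

(** Both sides are homogeneous, so the bound may be tested on a small multiple of [v], where [L] is
    close to the increment of [u]. *)
Lemma linear_le_of_lipschitz (u : V -> R[i]) (a : V) (L : {linear V -> R[i]})
    (r k : R) : 0 < r ->
  (forall e : R, 0 < e -> exists2 r : R, 0 < r & forall v, vnorm v < r ->
     normc (u (a + v) - u a - L v) <= e * vnorm v) ->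
  (forall v, vnorm v <= r -> normc (u (a + v) - u a) <= k * vnorm v) ->
  forall v, normc (L v) <= k * vnorm v.
Proof.
move=> r0 dL lip v.
have [->|v0] := eqVneq v 0.
  by rewrite linear0 normc0 vnorm0 mulr0.
have nv0 := vnorm_gt0 v0.
rewrite -ler_pdivrMr//; apply/ler_addgt0Pr => e e0; rewrite ler_pdivrMr//.
have [q q0 qL] := dL e e0.
pose s := Num.min r (q / 2) / vnorm v.
have s0 : 0 < s by rewrite divr_gt0// lt_min r0 divr_gt0.
have nsv : vnorm (s%:C *: v) = Num.min r (q / 2).
  by rewrite vnormZ normc_real gtr0_norm// divfK// gt_eqF.
have sr : vnorm (s%:C *: v) <= r by rewrite nsv ge_min lexx.
have sq : vnorm (s%:C *: v) < q by rewrite nsv gt_min orbC; apply/orP; left; lra.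
have := lip _ sr; have := qL _ sq.
set A := u (a + s%:C *: v) - u a => h1 h2.
have : normc (L (s%:C *: v)) <= (k + e) * vnorm (s%:C *: v).
  have -> : L (s%:C *: v) = A - (A - L (s%:C *: v)) by rewrite subKr.
  by apply: le_trans (normcB_le _ _) _; lra.
rewrite linearZ/= vnormZ -[s%:C *: L v]/(s%:C * L v) normcM normc_real gtr0_norm//.
by rewrite mulrCA ler_pM2l.
Qed.

(* By the Cauchy estimates, the differentials of u i at a converge at the same
   rate as u i. *)
Lemma differentiable_geometric_limit (u : nat -> V -> R[i]) (U : V -> R[i])
    (a : V) (r C : R) : 0 < r ->
  (forall i v, vnorm v < r -> differentiable (u i) (a + v)) ->
  (forall i v, vnorm v < r -> normc (U (a + v) - u i (a + v)) <= C / 2 ^+ i) ->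
  differentiable U a.
Proof.
move=> r0 ud uU.
have C0 : 0 <= C.
  have := uU 0%N 0; rewrite vnorm0 expr0 divr1 => /(_ r0).
  exact/le_trans/normc_ge0.
(* Differences [u j - u i] are bounded by [2 * C / 2 ^+ i]; the Lipschitz estimate multiplies this
   by [32 / r]. *)
pose k := 64 * C / r.
have k0 : 0 <= k by rewrite divr_ge0 ?mulr_ge0 ?(ltW r0).
have r80 : 0 < r / 8 by lra.
have r8 : r / 8 < r by lra.
have diffu i j : (i <= j)%N -> forall v, vnorm v < r ->
    normc ((u j \- u i) (a + v)) <= 2 * C / 2 ^+ i.
  move=> ij v vr /=.
  have := normc_tri (U (a + v)) (u j (a + v)) (u i (a + v)).
  rewrite [normc (u j _ - U _)]normc_distC.
  have := uU i v vr; have := uU j v vr.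
  have : C / 2 ^+ j <= C / 2 ^+ i.
    rewrite ler_wpM2l// lef_pV2 ?posrE ?exprn_gt0//.
    by rewrite ler_weXn2l// ler1n.
  have -> : 2 * C / 2 ^+ i = C / 2 ^+ i + C / 2 ^+ i.
    by field; rewrite expf_neq0.
  by lra.
have lip i j : (i <= j)%N -> forall v, vnorm v <= r / 8 ->
    normc ((u j \- u i) (a + v) - (u j \- u i) a) <= k / 2 ^+ i * vnorm v.
  move=> ij v vr.
  have -> : k / 2 ^+ i = 32 * (2 * C / 2 ^+ i) / r.
    by rewrite /k; field; rewrite expf_neq0//= gt_eqF.
  apply: bounded_differentiable_lipschitz vr => //; last exact: diffu.
  by move=> w wr; apply: differentiableB; exact: ud.
(* The estimate [lip] with [j] tending to infinity. *)
have lipU i v : vnorm v <= r / 8 ->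
    normc ((U \- u i) (a + v) - (U \- u i) a) <= k / 2 ^+ i * vnorm v.
  move=> vr; apply: (@le_geometric _ (2 * C)) => m.
  pose j := (i + m)%N.
  have := lip i j (leq_addr _ _) v vr.
  have := uU j v (le_lt_trans vr r8).
  have := uU j 0; rewrite vnorm0 addr0 => /(_ r0).
  have -> : (U \- u i) (a + v) - (U \- u i) a =
      (U (a + v) - u j (a + v)) - (U a - u j a) +
      ((u j \- u i) (a + v) - (u j \- u i) a) by move=> /=; ring.
  have := normcD_le ((U (a + v) - u j (a + v)) - (U a - u j a))
      ((u j \- u i) (a + v) - (u j \- u i) a).
  have := normcB_le (U (a + v) - u j (a + v)) (U a - u j a).
  have : C / 2 ^+ j <= C / 2 ^+ m.
    rewrite ler_wpM2l// lef_pV2 ?posrE ?exprn_gt0//.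
    by rewrite ler_weXn2l ?ler1n// leq_addl.
  have -> : 2 * C / 2 ^+ m = C / 2 ^+ m + C / 2 ^+ m.
    by field; rewrite expf_neq0.
  by lra.
have /choice[L LP] i : exists L : {linear V -> R[i]}, continuous L /\
    forall e : R, 0 < e -> exists2 r : R, 0 < r & forall v, vnorm v < r ->
     normc (u i (a + v) - u i a - L v) <= e * vnorm v.
  have := ud i 0; rewrite vnorm0 addr0 => /(_ r0) /differentiable_epsP[L cL dL].
  by exists L.
have Lcauchy i v : normc (L i.+1 v - L i v) <= k * vnorm v / 2 ^+ i.
  rewrite mulrAC.
  apply: (@linear_le_of_lipschitz (u i.+1 \- u i) a (L i.+1 \- L i)%R (r / 8)
    (k / 2 ^+ i) r80); last exact: lip.
  move=> e e0.
  have [q1 q10 q1P] := (LP i.+1).2 (e / 2) ltac:(lra).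
  have [q2 q20 q2P] := (LP i).2 (e / 2) ltac:(lra).
  exists (Num.min q1 q2) => [|w]; first by rewrite lt_min q10 q20.
  rewrite lt_min => /andP[/q1P w1 /q2P w2].
  have -> : (u i.+1 \- u i) (a + w) - (u i.+1 \- u i) a - (L i.+1 \- L i) w =
      (u i.+1 (a + w) - u i.+1 a - L i.+1 w) - (u i (a + w) - u i a - L i w).
    by move=> /=; ring.
  by apply: le_trans (normcB_le _ _) _; lra.
have /choice[D DP] v := geometric_limit (fun i => Lcauchy i v).
have Dlin : linear D.
  move=> z v w; apply/eqP; rewrite -subr_eq0; apply/eqP/eq0_normc/eqP.
  rewrite eq_le normc_ge0 andbT.
  pose M := 4 * (k * vnorm (z *: v + w)) + normc z * (4 * (k * vnorm v))
     + 4 * (k * vnorm w).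
  apply: (@le_geometric _ M) => i; rewrite add0r.
  have := DP (z *: v + w) i; have := DP v i; have := DP w i.
  set A := D (z *: v + w); set B := D v; set E := D w.
  rewrite linearP.
  have -> : A - (z *: B + E) =
      (A - (z *: L i v + L i w)) - z * (B - L i v) - (E - L i w).
    by rewrite -![z *: _]/(z * _); ring.
  have := normcB_le (A - (z *: L i v + L i w) - z * (B - L i v)) (E - L i w).
  have := normcB_le (A - (z *: L i v + L i w)) (z * (B - L i v)).
  rewrite normcM => h1 h2 h3 h4 h5.
  have := ler_wpM2l (normc_ge0 z) h4.
  rewrite /M !mulrDl -[normc z * _ / _]mulrA.
  by lra.
pose DL : {linear V -> R[i]} := HB.pack D (GRing.isLinear.Build _ _ _ _ D Dlin).
have DE v : DL v = D v by [].
apply/differentiable_epsP; exists DL.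
  (* [D] is bounded because [D - L 0] is bounded by [4 * k] and [L 0] is continuous. *)
  apply: bounded_linear_continuous; apply/linear_boundedP.
  have [M M0 MP] := linear_lipschitz (LP 0%N).1.
  have [M' M'0 ME] := gt0_complex M0.
  near=> q => v.
  apply: (@le_trans _ _ ((M' + 4 * k)%:C * `|v|)).
    rewrite (vnormE v) normcE -rmorphM/= lecR.
    have := DP v 0%N; rewrite expr0 divr1 => h1.
    have := MP v; rewrite (vnormE v) normcE ME -rmorphM/= lecR => h2.
    have := normcD_le (D v - L 0%N v) (L 0%N v); rewrite subrK.
    by lra.
  by rewrite ler_wpM2r//; near: q; apply: nbhs_pinfty_ge;
    apply/complex_realP; eexists.
move=> e e0.
(* Replacing [U] by [u i] costs [k / 2 ^+ i], replacing [D] by [L i] costs [4 * k / 2 ^+ i]. *)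
have [i ie] : exists i : nat, 5 * k / 2 ^+ i <= e / 2.
  exists (Num.truncn (5 * k / (e / 2))).+1.
  rewrite ler_pdivrMr ?exprn_gt0// [X in _ <= X]mulrC -ler_pdivrMr; last lra.
  rewrite ltW//; apply: lt_trans (truncnS_gt _) _.
  by rewrite -natrX ltr_nat ltn_expl.
have [q q0 qP] := (LP i).2 (e / 2) ltac:(lra).
exists (Num.min q (r / 8)) => [|v]; first by rewrite lt_min q0.
rewrite lt_min => /andP[vq /ltW vr]; rewrite DE.
have -> : U (a + v) - U a - D v = ((U \- u i) (a + v) - (U \- u i) a)
    + (u i (a + v) - u i a - L i v) - (D v - L i v) by move=> /=; ring.
have := normcB_le ((U \- u i) (a + v) - (U \- u i) a
    + (u i (a + v) - u i a - L i v)) (D v - L i v).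
have := normcD_le ((U \- u i) (a + v) - (U \- u i) a)
    (u i (a + v) - u i a - L i v).
have := qP v vq; have := lipU i v vr; have := DP v i.
have := ler_wpM2r (vnorm_ge0 v) ie.
have -> : 4 * (k * vnorm v) / 2 ^+ i = 4 * (k / 2 ^+ i * vnorm v).
  by field; rewrite expf_neq0.
have -> : 5 * k / 2 ^+ i * vnorm v = 5 * (k / 2 ^+ i * vnorm v).
  by field; rewrite expf_neq0.
by lra.
Unshelve. all: by end_near. Qed.

End Weierstrass.

(** * The compact-open topology on holomorphic functions *)

Section CompactOpenTopology.
Variables (R : realType) (N : nat) (M : complexManifold R N).

Definition holo_val (f : holo_space M) : M -> R[i] := set_val f.

Lemma holo_valP (f : holo_space M) : holomorphic (holo_val f).
Proof. exact: (set_mem (valP f)). Qed.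

Definition holo_of (f : M -> R[i]) (hf : holomorphic f) : holo_space M :=
  exist _ f (mem_set hf).

Lemma entourage_complexP (E : set (R[i] * R[i])) : entourage E <->
  exists2 e : R, 0 < e & forall z w, normc (w - z) < e -> E (z, w).
Proof.
rewrite -entourage_ballE; split=> [[_/= /gt0_complex[e e0 ->]] eE|[e e0 eE]].
  exists e => // z w zw; apply: eE => /=.
  by rewrite -ball_normE /= distrC normcE ltcR.
exists e%:C; first by rewrite /= ltcR.
move=> [z w] /=; rewrite -ball_normE /= distrC normcE ltcR.
exact: eE.
Qed.

Definition near_on (K : set M) (e : R) (g h : M -> R[i]) : Prop :=
  forall p, K p -> normc (h p - g p) < e.

Lemma near_on_nbhs (K : set M) (e : R) (g : {family compact, M -> R[i]}) :
  compact K -> 0 < e -> nbhs g [set h | near_on K e g h].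
Proof.
move=> cK e0.
have entE : entourage [set zw : R[i] * R[i] | normc (zw.2 - zw.1) < e].
  by apply/entourage_complexP; exists e.
exact: (fam_nbhs g entE cK).
Qed.

(** The sets [A] satisfying the conclusion form a filter, which converges to [g] uniformly on
    compact sets and hence contains every neighbourhood of [g]. *)
Lemma nbhs_near_on (g : {family compact, M -> R[i]}) (A : set (M -> R[i])) :
  nbhs g A -> exists K e, [/\ compact K, 0 < e & [set h | near_on K e g h] `<=` A].
Proof.
pose F : set_system (M -> R[i]) := [set A | exists K e,
  [/\ compact K, 0 < e & [set h | near_on K e g h] `<=` A]].
have FF : Filter F.
  split.
  - by exists set0, 1; split=> //; exact: compact0.
  - move=> P Q [K [e [cK e0 KP]]] [L [d [cL d0 LQ]]].
    exists (K `|` L), (Num.min e d); split.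
    + exact: compactU.
    + by rewrite lt_min e0.
    + move=> h hKL; split.
        by apply: KP => p Kp; have := hKL p (or_introl Kp); rewrite lt_min => /andP[].
      by apply: LQ => p Lp; have := hKL p (or_intror Lp); rewrite lt_min => /andP[].
  - move=> P Q PQ [K [e [cK e0 KP]]]; exists K, e; split=> //.
    exact: subset_trans PQ.
suff : F --> g by apply.
apply/fam_cvgP => K cK U /uniform_nbhs[E [/entourage_complexP[e e0 eE] EU]].
by exists K, e; split=> // h hK; apply: EU => p Kp; apply: eE; exact: hK.
Qed.

Lemma dense_holoP (u : nat -> holo_space M) : dense (range u) <->
  forall (g : M -> R[i]) (K : set M) (e : R), holomorphic g -> compact K ->
    0 < e -> exists l, near_on K e g (holo_val (u l)).
Proof.
split=> [du g K e hg cK e0|du O [g Og] oO].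
  have /set_val_continuous : nbhs (set_val (holo_of hg)) [set h | near_on K e g h].
    exact: near_on_nbhs.
  rewrite nbhsE /= => -[B [oB Bg] BK].
  have [x [/BK Kx [l _ lx]]] := du B (ex_intro _ _ Bg) oB.
  by exists l; rewrite lx.
have [B oB BO] : wopen (set_val : holo_space M -> _) O by [].
have Bg : nbhs (set_val g : {family compact, M -> R[i]}) B.
  by apply: open_nbhs_nbhs; split=> //; move: Og; rewrite -BO.
have [K [e [cK e0 KB]]] := nbhs_near_on Bg.
have [l lK] := du (holo_val g) K e (holo_valP g) cK e0.
exists (u l); split; last by exists l.
by rewrite -BO; apply: KB.
Qed.

Lemma iter_comp_op (phi : M -> M) (hphi : holomorphic_map phi) k f :
  holo_val (iter k (comp_op hphi) f) = holo_val f \o iter k phi.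
Proof.
elim: k => [//|k IH]; apply/funext => p.
rewrite /= -[in RHS]iterS iterSr.
by rewrite -[RHS]/((holo_val f \o iter k phi) (phi p)) -IH.
Qed.

End CompactOpenTopology.

(** * Polynomial cutoffs and blending *)

Section Cutoff.
Variable R : realType.
Implicit Types (w A B : R[i]) (c s : R).

(* A polynomial in w close to 0 near 0 and close to 1 near c, with an error
   O(c ^- 2) that survives multiplication by c. *)
Definition cutoff c w : R[i] := 1 - (1 - (w / c%:C) ^+ 2) ^+ 2.

Lemma normc_div_real c w : 0 < c -> normc (w / c%:C) = normc w / c.
Proof. by move=> c0; rewrite normcM normcV normc_real gtr0_norm. Qed.

Lemma cutoff_near0 c s w : 0 < c -> normc w <= s -> s <= c ->
  normc (cutoff c w) <= 3 * (s ^+ 2 / c ^+ 2).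
Proof.
move=> c0 ws sc; rewrite /cutoff; set t := w / c%:C.
have s0 : 0 <= s by apply: le_trans (normc_ge0 _) ws.
have nt : normc t <= s / c by rewrite normc_div_real// ler_pM2r ?invr_gt0.
have sc1 : s / c <= 1 by rewrite ler_pdivrMr// mul1r.
(* Writing 2 as a real scalar lets [normc_real] compute its modulus. *)
have -> : 1 - (1 - t ^+ 2) ^+ 2 = t * t * (2%:R%:C - t * t).
  by rewrite rmorph_nat; ring.
have -> : s ^+ 2 / c ^+ 2 = (s / c) * (s / c) by field; rewrite gt_eqF.
rewrite normcM mulrC ler_pM ?normc_ge0//; last first.
  by rewrite normcM ler_pM ?normc_ge0.
apply: le_trans (normcB_le _ _) _; rewrite normc_real ger0_norm// normcM.
by have := normc_ge0 t; nra.
Qed.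

Lemma cutoff_near1 c s w : 0 < c -> normc (w - c%:C) <= s -> s <= c ->
  normc (1 - cutoff c w) <= 9 * (s ^+ 2 / c ^+ 2).
Proof.
move=> c0 ws sc; rewrite /cutoff subKr.
have cC0 : c%:C != 0 :> R[i] by rewrite -[0]/(0%:C) (inj_eq (@complexI R)) gt_eqF.
set t := (w - c%:C) / c%:C.
have -> : w / c%:C = 1 + t by rewrite /t; field.
have s0 : 0 <= s by apply: le_trans (normc_ge0 _) ws.
have nt : normc t <= s / c by rewrite normc_div_real// ler_pM2r ?invr_gt0.
have sc1 : s / c <= 1 by rewrite ler_pdivrMr// mul1r.
have sc0 : 0 <= s / c by rewrite divr_ge0// ltW.
have -> : (1 - (1 + t) ^+ 2) ^+ 2 = (t * (2%:R%:C + t)) * (t * (2%:R%:C + t)).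
  by rewrite rmorph_nat; ring.
have -> : 9 * (s ^+ 2 / c ^+ 2) = (s / c * 3) * (s / c * 3).
  by field; rewrite gt_eqF.
have h : normc (t * (2%:R%:C + t)) <= s / c * 3.
  rewrite normcM ler_pM ?normc_ge0//.
  by apply: le_trans (normcD_le _ _) _; rewrite normc_real ger0_norm//; lra.
by rewrite normcM ler_pM ?normc_ge0.
Qed.

Definition blend c w A B : R[i] := B * (1 - cutoff c w) + (A - c%:C) * cutoff c w.

(** The cutoff error of order s^2 / c^2 is multiplied by a factor of modulus at most 2 s + c <= 3 c,
    which leaves order s^2 / c. The estimate near [c] works the same way. *)
Lemma blend_near0 c s w A B : 0 < c -> s <= c ->
  normc w <= s -> normc A <= s -> normc B <= s ->
  normc (blend c w A B - B) <= 9 * (s ^+ 2 / c).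
Proof.
move=> c0 sc ws As Bs.
have s0 : 0 <= s by apply: le_trans (normc_ge0 _) ws.
have -> : blend c w A B - B = (A - c%:C - B) * cutoff c w by rewrite /blend; ring.
have -> : 9 * (s ^+ 2 / c) = (3 * c) * (3 * (s ^+ 2 / c ^+ 2)).
  by field; rewrite gt_eqF.
rewrite normcM ler_pM ?normc_ge0//; last exact: cutoff_near0.
apply: le_trans (normcB_le _ _) _.
have := normcB_le A c%:C; rewrite normc_real gtr0_norm//.
by lra.
Qed.

Lemma blend_near1 c s w A B A' : 0 < c -> s <= c ->
  normc (w - c%:C) <= s -> normc (A - c%:C) <= s -> normc (B - c%:C) <= s ->
  normc (blend c w A B - A') <= normc (A - c%:C - A') + 27 * (s ^+ 2 / c).
Proof.
move=> c0 sc ws As Bs.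
have s0 : 0 <= s by apply: le_trans (normc_ge0 _) ws.
have -> : blend c w A B - A' = (A - c%:C - A') +
    ((B - c%:C) - (A - c%:C) + c%:C) * (1 - cutoff c w) by rewrite /blend; ring.
apply: le_trans (normcD_le _ _) _; rewrite lerD2l.
have -> : 27 * (s ^+ 2 / c) = (3 * c) * (9 * (s ^+ 2 / c ^+ 2)).
  by field; rewrite gt_eqF.
rewrite normcM ler_pM ?normc_ge0//; last exact: cutoff_near1.
apply: le_trans (normcD_le _ _) _.
have := normcB_le (B - c%:C) (A - c%:C); rewrite normc_real gtr0_norm//.
by lra.
Qed.

End Cutoff.

(** * Operations on holomorphic functions, continuity and boundedness on compact sets *)

Section HolomorphicFunctions.
Variables (R : realType) (N : nat) (M : complexManifold R N).
Implicit Types (f g : M -> R[i]).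

Lemma chart_inv_continuous_at (c : chart R N M) (x : M) : chart_dom c x ->
  {for c x, continuous (chart_inv c)}.
Proof.
move=> cx; have := @chart_inv_continuous _ _ _ c.
rewrite continuous_open_subspace; last exact: chart_img_open.
by apply; rewrite inE; exists x.
Qed.

Lemma chart_map_continuous_at (c : chart R N M) (x : M) : chart_dom c x ->
  {for x, continuous c}.
Proof.
move=> cx; have := @chart_map_continuous _ _ _ c.
rewrite continuous_open_subspace; last exact: chart_dom_open.
by apply; rewrite inE.
Qed.

Lemma holomorphic_cst (a : R[i]) : holomorphic (fun _ : M => a).
Proof. by move=> c ac x cx; exact: differentiable_cst. Qed.

Lemma holomorphicD f g : holomorphic f -> holomorphic g ->
  holomorphic (fun p => f p + g p).
Proof.
by move=> hf hg c ac x cx; apply: differentiableD; [exact: hf|exact: hg].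
Qed.

Lemma holomorphicM f g : holomorphic f -> holomorphic g ->
  holomorphic (fun p => f p * g p).
Proof.
by move=> hf hg c ac x cx; apply: differentiableM; [exact: hf|exact: hg].
Qed.

Lemma holomorphicN f : holomorphic f -> holomorphic (fun p => - f p).
Proof. by move=> hf c ac x cx; apply: differentiableN; exact: hf. Qed.

Lemma holomorphic_blend (c : R) f g h :
  holomorphic f -> holomorphic g -> holomorphic h ->
  holomorphic (fun p => blend c (f p) (g p) (h p)).
Proof.
move=> hf hg hh.
have hB (u v : M -> R[i]) : holomorphic u -> holomorphic v ->
    holomorphic (fun p => u p - v p).
  by move=> hu hv; exact: (holomorphicD hu (holomorphicN hv)).
have h1 := holomorphic_cst 1.
have hX : holomorphic (fun p => cutoff c (f p)).
  have hw : holomorphic (fun p => f p / c%:C).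
    exact: (holomorphicM hf (holomorphic_cst _)).
  have hv := hB _ _ h1 (holomorphicM hw hw).
  exact: (hB _ _ h1 (holomorphicM hv hv)).
have hg' := hB _ _ hg (holomorphic_cst c%:C).
exact: (holomorphicD (holomorphicM hh (hB _ _ h1 hX)) (holomorphicM hg' hX)).
Qed.

Lemma holomorphic_iter (phi : M -> M) : holomorphic_map phi ->
  forall k f, holomorphic f -> holomorphic (f \o iter k phi).
Proof.
move=> hphi k f hf; have := holo_valP (iter k (comp_op hphi) (holo_of hf)).
by rewrite iter_comp_op.
Qed.

Lemma holomorphic_continuous f : holomorphic f -> continuous f.
Proof.
move=> hf x; have [c ac cx] := atlas_cover x.
have cf : {for x, continuous ((f \o chart_inv c) \o c)}.
  apply: continuous_comp; first exact: chart_map_continuous_at.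
  exact/differentiable_continuous/hf.
have ex : ((f \o chart_inv c) \o c) x = f x by rewrite /= chart_mapK.
have {}cf : ((f \o chart_inv c) \o c) @ x --> f x.
  by rewrite -ex; exact: cf.
apply: cvg_trans cf; apply: near_eq_cvg.
have : nbhs x (chart_dom c).
  by apply: open_nbhs_nbhs; split=> //; exact: chart_dom_open.
by apply: filterS => y cy /=; rewrite chart_mapK.
Qed.

Lemma holomorphic_bounded f (K : set M) : holomorphic f -> compact K ->
  exists B : R, forall p, K p -> normc (f p) <= B.
Proof.
move=> hf /compact_near_coveringP cK.
have : \forall i \near \oo, K `<=` [set p | normc (f p) <= i%:R].
  apply: cK => p Kp.
  have pB : \forall q \near p, normc (f q) <= normc (f p) + 1.
    have /holomorphic_continuous/(_ p)/cvgrPdist_lt/(_ 1 ltr01) := hf.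
    apply: filterS => q; rewrite normcE -[1]/(1%:C) ltcR => fq.
    have := normcB_ge (f q) (f p); rewrite [normc (f q - _)]normc_distC.
    by lra.
  have iB : \forall i \near \oo, normc (f p) + 1 <= i%:R.
    exists (Num.truncn (normc (f p) + 1)).+1 => // i /=.
    rewrite -(ler_nat R); apply: le_trans; apply: ltW; exact: truncnS_gt.
  near=> q i => /=.
  apply: (@le_trans _ _ (normc (f p) + 1)); first by near: q.
  by near: i.
move=> [i _ /(_ i (leqnn i)) KB]; exists i%:R; exact: KB.
Unshelve. all: by end_near. Qed.

End HolomorphicFunctions.

(** * Mixing and universality *)

Section Exhaustion.
Variables (M : topologicalType) (K : nat -> set M).
Hypothesis Kint : forall l, K l `<=` (K l.+1)^°.
Hypothesis Kcover : \bigcup_l K l = [set: M].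

Lemma exhaustion_mono i j : (i <= j)%N -> K i `<=` K j.
Proof.
move=> /subnKC <-; elim: (j - i)%N => [|m IH]; first by rewrite addn0.
rewrite addnS; apply: subset_trans IH _.
by move=> p /Kint; exact: interior_subset.
Qed.

Lemma exhaustion_absorb (L : set M) : compact L ->
  exists i0, forall i, (i0 <= i)%N -> L `<=` K i.
Proof.
move=> /compact_near_coveringP cL.
have [i0 _ H] : \forall i \near \oo, L `<=` K i.
  apply: cL => p Lp.
  have [l _ Kp] : (\bigcup_l K l) p by rewrite Kcover.
  have pK : \forall q \near p, K l.+1 q := Kint Kp.
  have iK : \forall i \near \oo, (l.+1 <= i)%N by exists l.+1.
  near=> q i => /=.
  have qK : K l.+1 q by near: q.
  by apply: exhaustion_mono qK; near: i.
by exists i0.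
Unshelve. all: by end_near. Qed.

End Exhaustion.

Section Transitivity.
Variables (R : realType) (N : nat) (M : complexManifold R N).
Variables (phi : M -> M) (hphi : holomorphic_map phi).
Variables (K : nat -> set M).
Hypothesis Kcompact : forall l, compact (K l).
Hypothesis Kint : forall l, K l `<=` (K l.+1)^°.
Hypothesis Kcover : \bigcup_l K l = [set: M].
Variables (n : nat -> nat) (f : M -> R[i]).
Hypothesis hf : holomorphic f.
Hypothesis f_dense : forall (g : M -> R[i]) (L : set M) (e : R),
  holomorphic g -> compact L -> 0 < e ->
  exists l, near_on L e g (f \o iter (n l) phi).

Lemma iter_compact k (L : set M) : compact L -> compact (iter k phi @` L).
Proof.
move=> cL; elim: k => [|k IH]; first by rewrite image_id.
have -> : iter k.+1 phi @` L = phi @` (iter k phi @` L).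
  by rewrite -image_comp.
apply: continuous_compact => //; apply: continuous_subspaceT.
exact: hphi.1.
Qed.

(** Density yields some index for each target [c + f], with no control on its size. Adding [x0] to
    the compact set lets a large [c] rule out the indices used so far, so that [k] increases. *)
Lemma translates_exist (x0 : M) : exists (k : nat -> nat) (c : nat -> R),
  increasing_seq k /\ forall j, j%:R <= c j /\
    near_on (K j) j.+1%:R^-1 (fun p => (c j)%:C + f p) (f \o iter (n (k j)) phi).
Proof.
have step (q : nat * nat) : exists t : nat * R, [/\ (q.2 < t.1)%N, q.1%:R <= t.2 &
    near_on (K q.1) q.1.+1%:R^-1 (fun p => (t.2)%:C + f p)
      (f \o iter (n t.1) phi)].
  case: q => j m /=.
  (* A translation by c > S excludes the indices l <= m at the point x0. *)
  pose S := \sum_(l < m.+1) normc (f (iter (n l) phi x0) - f x0).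
  have S0 : 0 <= S by apply: sumr_ge0 => l _; exact: normc_ge0.
  (* The term [j] gives [j%:R <= c]; [S + 1] forces an error of at least 1 at [x0] for every index
     up to [m], whereas the error is below [j.+1%:R^-1]. *)
  have [c cE] : exists c : R, c = j%:R + S + 1 by eexists.
  have j0 : (0 : R) <= j%:R by [].
  have [|||l lP] := @f_dense (fun p => c%:C + f p) (K j `|` [set x0]) j.+1%:R^-1.
  - exact: (holomorphicD (@holomorphic_cst R N M c%:C) hf).
  - by apply: compactU => //; exact: compact_set1.
  - by rewrite invr_gt0.
  exists (l, c) => /=; split.
  - rewrite ltnNge; apply/negP => lm.
    pose d := f (iter (n l) phi x0).
    have dc : normc (d - (c%:C + f x0)) < j.+1%:R^-1 := lP x0 (or_intror erefl).
    have dS : normc (d - f x0) <= S.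
      rewrite /S (bigD1 (inord l)) //= inordK ?ltnS// -/d lerDl.
      by apply: sumr_ge0 => i _; exact: normc_ge0.
    have j1 : (j.+1%:R : R)^-1 <= 1 by rewrite invf_le1// ler1n.
    have := normcB_ge c%:C (d - f x0).
    have -> : c%:C - (d - f x0) = - (d - (c%:C + f x0)) by ring.
    rewrite normc_opp normc_real ger0_norm; last by rewrite cE; lra.
    have := lt_le_trans dc j1.
    by lra.
  - by rewrite cE; lra.
  - by move=> p Kp; apply: lP; left.
have [F FP] := choice step.
pose k := fix k j := if j is j'.+1 then (F (j, k j')).1 else (F (0%N, 0%N)).1.
pose c j := if j is j'.+1 then (F (j, k j')).2 else (F (0%N, 0%N)).2.
exists k, c; split.
  by apply/increasing_seqP => j; have [] := FP (j.+1, k j).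
by case=> [|j]; [have [] := FP (0%N, 0%N)|have [] := FP (j.+1, k j)].
Qed.

Section Mixing.
Variables (k : nat -> nat) (c : nat -> R).
Hypothesis kc : forall j, j%:R <= c j /\
  near_on (K j) j.+1%:R^-1 (fun p => (c j)%:C + f p) (f \o iter (n (k j)) phi).

(* Since phi-iterates commute, f o phi^(n (k j)) ~ c j + f forces the same
   relation for every f o phi^(n a), and these are dense. *)
Lemma translates_mixing (y g : M -> R[i]) (L L' : set M) (e : R) :
  holomorphic y -> holomorphic g -> compact L -> compact L' -> 0 < e ->
  exists j0, forall j, (j0 <= j)%N -> exists z : M -> R[i],
    [/\ holomorphic z, near_on L e y z &
        near_on L' e g (z \o iter (n (k j)) phi)].
Proof.
move=> hy hg cL cL' e0.
have e40 : 0 < e / 4 by rewrite divr_gt0.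
have [b bP] := f_dense hy cL e40.
have [a aP] := f_dense hg cL' e40.
pose Fa := f \o iter (n a) phi; pose Fb := f \o iter (n b) phi.
have hFa : holomorphic Fa by exact: holomorphic_iter.
have hFb : holomorphic Fb by exact: holomorphic_iter.
have cLL : compact (L `|` L') by exact: compactU.
have [B0 B0P] := holomorphic_bounded hf cLL.
have [B1 B1P] := holomorphic_bounded hFa cLL.
have [B2 B2P] := holomorphic_bounded hFb cLL.
(* A common bound for [f], [Fa], [Fb]; the extra 1 absorbs the error [j.+1%:R^-1] after
   translation. *)
pose s : R := `|B0| + `|B1| + `|B2| + 1.
have [B00 B10 B20] := And3 (normr_ge0 B0) (normr_ge0 B1) (normr_ge0 B2).
have [B01 B11 B21] := And3 (ler_norm B0) (ler_norm B1) (ler_norm B2).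
have s1 : 1 <= s by rewrite /s; lra.
(* [K j] has to contain [L'] and its images under both iterates, because [kc] is applied at [p] and
   at its images under [iter (n a) phi] and [iter (n b) phi]. *)
have [i0 i0P] := exhaustion_absorb Kint Kcover cL'.
have [i1 i1P] := exhaustion_absorb Kint Kcover (@iter_compact (n a) _ cL').
have [i2 i2P] := exhaustion_absorb Kint Kcover (@iter_compact (n b) _ cL').
(* The three terms ensure [s <= C], a blending error at most [e / 4], and [j.+1%:R^-1 <= e / 4]. *)
pose T : R := s + 27 * s ^+ 2 * (4 / e) + 4 / e.
exists (maxn (maxn i0 (maxn i1 i2)) (Num.truncn T).+1) => j.
rewrite !geq_max => /andP[/and3P[j0 j1 j2] jT].
have [jc] := kc j; set C := c j => near.
have T_j : T < j%:R by apply: lt_le_trans (truncnS_gt T) _; rewrite ler_nat.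
have TC : T < C by apply: lt_le_trans jc.
have e4 : 0 < 4 / e by rewrite divr_gt0.
have s2 : 0 <= 27 * s ^+ 2 * (4 / e).
  by rewrite mulr_ge0 ?(ltW e4)// mulr_ge0 ?sqr_ge0.
have sC : s <= C by move: TC; rewrite /T; lra.
have C0 : 0 < C by lra.
have small : 27 * (s ^+ 2 / C) <= e / 4.
  rewrite mulrA ler_pdivrMr// -ler_pdivrMl// invf_div mulrC.
  by move: TC; rewrite /T; lra.
have jinv : (j.+1%:R : R)^-1 <= e / 4.
  rewrite -[e / 4]invf_div lef_pV2 ?posrE//.
  apply: le_trans (_ : j%:R <= _); last by rewrite ler_nat.
  by move: T_j; rewrite /T; lra.
have jinv1 : (j.+1%:R : R)^-1 <= 1 by rewrite invf_le1// ler1n.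
move: (j.+1%:R^-1) near jinv jinv1 => d near jinv jinv1.
pose z p := blend C (f p) (Fa p) (Fb p).
exists z; split; first exact: holomorphic_blend.
  move=> p Lp.
  have h : normc (z p - Fb p) <= 9 * (s ^+ 2 / C).
    apply: blend_near0 => //; rewrite /s.
    - by have := B0P p (or_introl Lp); lra.
    - by have := B1P p (or_introl Lp); lra.
    - by have := B2P p (or_introl Lp); lra.
  have sC2 : 0 <= s ^+ 2 / C by rewrite divr_ge0 ?sqr_ge0 ?(ltW C0).
  have := normc_tri (Fb p) (z p) (y p); have := bP p Lp.
  by rewrite -[(f \o iter (n b) phi) p]/(Fb p); lra.
move=> p Lp; set q := iter (n (k j)) phi p.
(* Here the commutation of iterates enters: [iter m phi q] is the [n (k j)]-th iterate of
   [iter m phi p]. *)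
have shift m : iter m phi p \in K j ->
    normc (f (iter m phi q) - (C%:C + f (iter m phi p))) < d.
  move=> /set_mem Kp; have := near _ Kp.
  by rewrite /= /q -!iterD addnC.
have sf : normc (f q - (C%:C + f p)) < d.
  by apply: (shift 0%N); apply/mem_set/i0P.
have sa : normc (Fa q - (C%:C + Fa p)) < d.
  by apply: shift; apply/mem_set/i1P => //; exists p.
have sb : normc (Fb q - (C%:C + Fb p)) < d.
  by apply: shift; apply/mem_set/i2P => //; exists p.
have tr (u v : R[i]) : normc (u - (C%:C + v)) < d ->
    normc (u - C%:C) <= normc v + 1.
  move=> uv; have -> : u - C%:C = (u - (C%:C + v)) + v by ring.
  by apply: le_trans (normcD_le _ _) _; lra.
have h : normc (z q - Fa p) <= normc (Fa q - C%:C - Fa p) + 27 * (s ^+ 2 / C).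
  apply: blend_near1 => //; rewrite /s.
  - by have := tr _ _ sf; have := B0P p (or_intror Lp); lra.
  - by have := tr _ _ sa; have := B1P p (or_intror Lp); lra.
  - by have := tr _ _ sb; have := B2P p (or_intror Lp); lra.
have E : Fa q - C%:C - Fa p = Fa q - (C%:C + Fa p) by rewrite opprD addrA.
rewrite E in h.
have := normc_tri (Fa p) (z q) (g p); have := aP p Lp.
rewrite -[(f \o iter (n a) phi) p]/(Fa p) -[(z \o _) p]/(z q).
by lra.
Qed.

End Mixing.

End Transitivity.

Section Construction.
Variables (R : realType) (N : nat) (M : complexManifold R N).
Variables (K : nat -> set M).
Hypothesis Kcompact : forall l, compact (K l).
Hypothesis Kint : forall l, K l `<=` (K l.+1)^°.
Hypothesis Kcover : \bigcup_l K l = [set: M].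

Lemma holomorphic_geometric_limit (y : nat -> M -> R[i]) (X : M -> R[i]) (C : R) :
  (forall i, holomorphic (y i)) ->
  (forall i p, K i p -> normc (X p - y i p) <= C / 2 ^+ i) ->
  holomorphic X.
Proof.
move=> hy yX c ac x cx.
have [l _ Kx] : (\bigcup_l K l) x by rewrite Kcover.
have cinv := chart_inv_continuous_at cx.
have nK : nbhs (chart_inv c (c x)) (K l.+1) by rewrite (chart_mapK cx); exact: Kint.
have nI : nbhs (c x) (c @` chart_dom c).
  by apply: open_nbhs_nbhs; split; [exact: chart_img_open|exists x].
have nIK : nbhs (c x) (c @` chart_dom c `&` chart_inv c @^-1` K l.+1).
  by apply: filterI => //; exact: cinv.
have [r r0 rP] := (nbhs_vnormP _ _).1 nIK.
(* Near [x] the points lie in [K l.+1], so the error bound is available from index [l.+1] on; hence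
   the shift. *)
apply: (@differentiable_geometric_limit _ _ (fun i => y (l.+1 + i)%N \o chart_inv c)
  _ _ r C r0).
  by move=> i v /rP[[x' cx' <-] _]; exact: hy.
move=> i v /rP[_ /= Kv].
have C0 : 0 <= C.
  have := le_trans (normc_ge0 _) (yX _ _ Kx).
  by rewrite pmulr_lge0// invr_gt0 exprn_gt0.
apply: le_trans (yX _ _ (exhaustion_mono Kint (leq_addr _ _) Kv)) _.
rewrite ler_wpM2l// lef_pV2 ?posrE ?exprn_gt0//.
by rewrite ler_weXn2l ?ler1n// leq_addl.
Qed.

Variables (T : nat -> M -> M) (G : nat -> M -> R[i]).
Hypothesis T_compact : forall j L, compact L -> compact (T j @` L).
Hypothesis T_mixing : forall a (y : M -> R[i]) (L L' : set M) (e : R),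
  holomorphic y -> compact L -> compact L' -> 0 < e ->
  exists j (z : M -> R[i]),
    [/\ holomorphic z, near_on L e y z & near_on L' e (G a) (z \o T j)].

(* logn 2 i.+1 takes each value for infinitely many i, so that each G a is
   approximated with arbitrarily small error. *)
Lemma universal_function_exists : exists2 X : M -> R[i], holomorphic X &
  forall a L e, compact L -> 0 < e -> exists j, near_on L e (G a) (X \o T j).
Proof.
pose P i (y : M -> R[i]) (L : set M) (t : nat * (M -> R[i])) :=
  holomorphic y -> compact L ->
  [/\ holomorphic t.2, near_on L (2 ^+ i)^-1 y t.2 &
      near_on (K i) (2 ^+ i)^-1 (G (logn 2 i.+1)) (t.2 \o T t.1)].
have /choice[F FP] (q : nat * ((M -> R[i]) * set M)) : exists t, P q.1 q.2.1 q.2.2 t.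
  case: q => i [y L] /=.
  have [hy|nhy] := pselect (holomorphic y); last by exists (0%N, y) => /nhy.
  have [cL|ncL] := pselect (compact L); last by exists (0%N, y) => _ /ncL.
  have [||j [z zP]] := @T_mixing (logn 2 i.+1) y L (K i) (2 ^+ i)^-1 hy cL => //.
  by exists (j, z).
pose S := fix S i : (M -> R[i]) * set M := if i is i'.+1 then
    ((F (i', S i')).2, (S i').2 `|` (K i `|` T (F (i', S i')).1 @` K i'))
  else (fun=> 0, K 0%N).
pose y i := (S i).1; pose L i := (S i).2; pose j i := (F (i, S i)).1.
have SP i : holomorphic (y i) /\ compact (L i).
  elim: i => [|i [hy cL]].
    by split; [exact: (@holomorphic_cst R N M 0)|exact: Kcompact].
  have [hz _ _] := FP (i, S i) hy cL.
  split; first exact: hz.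
  apply: compactU => //; apply: compactU; first exact: Kcompact.
  exact/T_compact/Kcompact.
have yS i : near_on (L i) (2 ^+ i)^-1 (y i) (y i.+1).
  by have [hy cL] := SP i; have [] := FP (i, S i) hy cL.
have yT i : near_on (K i) (2 ^+ i)^-1 (G (logn 2 i.+1)) (y i.+1 \o T (j i)).
  by have [hy cL] := SP i; have [] := FP (i, S i) hy cL.
have KL i : K i `<=` L i by case: i => [//|i] p Kp; right; left.
have LS i m : L i `<=` L (i + m)%N.
  elim: m => [|m IH]; first by rewrite addn0.
  by rewrite addnS => p /IH Lp; left.
have TL i p : K i p -> L i.+1 (T (j i) p) by move=> Kp; right; right; exists p.
have /choice[X XP] p : exists l, forall i, L i p -> normc (l - y i p) <= 4 / 2 ^+ i.
  (* From the least index [i0] with [p] in [L i0], the values at [p] form a geometrically convergent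
     sequence, with errors relative to [2 ^+ i0]. *)
  have exL : exists i, `[< L i p >].
    have [i _ Kp] : (\bigcup_l K l) p by rewrite Kcover.
    by exists i; apply/asboolP/KL.
  case: (ex_minnP exL) => i0 /asboolP L0 min0.
  have [|l lP] := @geometric_limit R (fun i => y (i0 + i)%N p) (2 ^+ i0)^-1.
    move=> i; rewrite -invfM -exprD addnS; apply: ltW; apply: yS.
    exact: LS.
  exists l => i /asboolP/min0 /subnKC <-.
  by apply: le_trans (lP _) _; rewrite -mulrA -invfM -exprD.
have hX : holomorphic X.
  apply: (@holomorphic_geometric_limit y X 4) => [i|i p Kp]; first by have [] := SP i.
  exact/XP/KL.
exists X => // a A e cA e0.
have [i0 i0P] := exhaustion_absorb Kint Kcover cA.
pose m := maxn i0 (Num.truncn (3 / e)).+1.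
have [i im ia] : exists2 i, (m <= i)%N & logn 2 i.+1 = a.
  (* The factor [3 ^ m] makes the index large without changing the 2-adic valuation of [i.+1]. *)
  exists (2 ^ a * 3 ^ m).-1.
    rewrite -ltnS prednK ?muln_gt0 ?expn_gt0//.
    by rewrite (leq_trans (ltn_expl m (isT : 1 < 3)%N))// leq_pmull ?expn_gt0.
  rewrite prednK ?muln_gt0 ?expn_gt0// lognM ?expn_gt0// pfactorK//.
  by rewrite lognX (@lognE 2 3) /= muln0 addn0.
(* The limit differs from [y i.+1] by at most [4 / 2 ^+ i.+1], that is [2 / 2 ^+ i], and the
   approximation of [G a] adds [1 / 2 ^+ i]. *)
have ie : 3 / 2 ^+ i <= e.
  rewrite ler_pdivrMr ?exprn_gt0// mulrC -ler_pdivrMr// ltW//.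
  apply: lt_le_trans (truncnS_gt _) _.
  rewrite -natrX ler_nat (leq_trans _ (ltnW (ltn_expl i (isT : 1 < 2)%N)))//.
  by apply: leq_trans im; rewrite leq_maxr.
exists (j i) => p Ap.
have Kp : K i p by apply: i0P Ap; apply: leq_trans im; rewrite leq_maxl.
have := normc_tri (y i.+1 (T (j i) p)) (X (T (j i) p)) (G a p).
have := yT i p Kp; rewrite ia -[(_ \o _) p]/(y i.+1 (T (j i) p)).
have := XP _ _ (TL i p Kp).
have -> : 4 / 2 ^+ i.+1 = 2 * (2 ^+ i)^-1 :> R.
  by rewrite exprS; field; rewrite expf_neq0.
rewrite -[(_ \o _) p]/(X (T (j i) p)).
by lra.
Qed.

End Construction.

(** * Hypercyclic and hereditarily hypercyclic composition operators *)

Theorem mainTheorem8 (R : realType) (N : nat) (Omega : complexManifold R N)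
    (stein_Omega : stein Omega) (connected_Omega : connected [set: Omega])
    (phi : Omega -> Omega) (hphi : holomorphic_map phi)
    (n : nat -> nat) (incr_n : increasing_seq n) :
  hypercyclic_wrt (comp_op hphi) n <->
  exists2 k : nat -> nat, increasing_seq k &
    hereditarily_hypercyclic_wrt (comp_op hphi) (n \o k).
Proof.
split; last first.
  (* A function universal for a subsequence is universal for the whole sequence. *)
  move=> [k _ /(_ id)[|f df]]; first by apply/increasing_seqP => i; exact: ltnSn.
  exists f => O O0 oO; have [x [Ox [l _ lx]]] := df O O0 oO.
  by exists x; split=> //; exists (k l).
move=> [f /dense_holoP df].
(* On the empty manifold every approximation holds vacuously; otherwise a base point is available
   for the translates. *)
have [[x0 _]|noM] := pselect (exists x0 : Omega, True); last first.
  exists id; first by apply/increasing_seqP => i; exact: ltnSn.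
  move=> s _; exists f; apply/dense_holoP => g K e _ _ _.
  by exists 0%N => p; case: noM; exists p.
case: stein_Omega => -[K [cK iK coverK]] _ _ _.
have hf := holo_valP f.
have f_dense g L e : holomorphic g -> compact L -> 0 < e ->
    exists l, near_on L e g (holo_val f \o iter (n l) phi).
  by move=> hg cL /(df g L e hg cL)[l]; rewrite iter_comp_op; exists l.
have [k [c [incr_k kc]]] := translates_exist cK hf f_dense x0.
exists k => // s incr_s.
(* Mixing holds for all indices beyond some [j0], hence at [s j0]; so every subsequence inherits the
   transitivity needed. *)
have s_ge i : (i <= s i)%N.
  elim: i => // i /leq_ltn_trans; apply.
  by move/increasing_seqP : incr_s; exact.
pose T j := iter (n (k (s j))) phi.
have T_mixing a (y : Omega -> R[i]) (L L' : set Omega) (e : R) :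
    holomorphic y -> compact L -> compact L' -> 0 < e ->
    exists j (z : Omega -> R[i]), [/\ holomorphic z, near_on L e y z &
      near_on L' e (holo_val f \o iter (n a) phi) (z \o T j)].
  move=> hy cL cL' e0.
  have hFa : holomorphic (holo_val f \o iter (n a) phi) by exact: holomorphic_iter.
  have [j0 /(_ _ (s_ge j0)) [z zP]] :=
    translates_mixing hphi iK coverK hf f_dense kc hy hFa cL cL' e0.
  by exists j0, z.
(* The countable family [G] consists of the dense orbit of [f], so approximating its members
   suffices for density. *)
have [X hX XP] := universal_function_exists cK iK coverK
  (fun j L => @iter_compact _ _ _ _ hphi _ L) T_mixing.
exists (holo_of hX); apply/dense_holoP => g L e hg cL e0.
have e20 : 0 < e / 2 by rewrite divr_gt0.
have [a aP] := f_dense g L (e / 2) hg cL e20.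
have [j jP] := XP a L (e / 2) cL e20.
exists j => p Lp; rewrite iter_comp_op.
have := normc_tri ((holo_val f \o iter (n a) phi) p)
  ((holo_val (holo_of hX) \o iter ((n \o k \o s) j) phi) p) (g p).
have := aP p Lp; have := jP p Lp.
rewrite -[(X \o T j) p]/((holo_val (holo_of hX) \o iter ((n \o k \o s) j) phi) p).
by lra.
Qed.
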